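(* Let $p=p(n)$ be a function of the positive integer $n$ with $p(n)\in[0,1]$ for all $n$. Suppose that at least one of the following holds: (i) $p(n)\ll n^{-1}$; (ii) for some positive integer $k$, $n^{-1/k}\ll p(n)\ll n^{-1/(k+1)}$; (iii) for all $\epsilon>0$, $n^{-\epsilon}\ll p(n)$ and $n^{-\epsilon}\ll 1-p(n)$; (iv) for some positive integer $k$, $n^{-1/k}\ll 1-p(n)\ll n^{-1/(k+1)}$; (v) $1-p(n)\ll n^{-1}$. Then $p(n)$ satisfies the Zero-One Law for circular unary predicates. Conversely, if $p(n)$ satisfies none of (i)--(v), then $p(n)$ does not satisfy the Zero-One Law for circular unary predicates.
   Context: Notation: $f(n)\ll g(n)$ means $f(n)/g(n)\to 0$ as $n\to\infty$ (and, for $f$ possibly zero, $n^{-a}\ll f(n)$ means $f(n)n^{a}\to\infty$). For a positive integer $n$ and $0\le p\le 1$, the random unary predicate $U_{n,p}$ is the probability space over unary predicates $U$ on $[n]=\{1,\ldots,n\}$ in which $\Pr[U(x)]=p$ for each $1\le x\le n$, the events $U(x)$, $1\le x\le n$, being mutually independent. The circular language is the first order language with equality, a unary predicate symbol $U$ and a ternary predicate symbol $C$. On $[n]$ the predicate $C$ is built in: $C(x,y,z)$ holds if and only if $x<y<z$ or $y<z<x$ or $z<x<y$. For a sentence $S$ in the circular language, $\Pr[U_{n,p}\models S]$ is the probability that the structure $\langle [n],C,U\rangle$, with $U$ drawn from $U_{n,p}$, satisfies $S$. A function $p=p(n)$ satisfies the Zero-One Law for circular unary predicates if for every sentence $S$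 in the circular language, $\lim_{n\to\infty}\Pr[U_{n,p(n)}\models S]$ exists and equals $0$ or $1$. *)

(* Defs.v *)
(* MathComp-Analysis; the reals are an arbitrary R : realType. *)
From HB Require Import structures.
From mathcomp Require Import all_boot all_order all_algebra.
From mathcomp Require Import all_classical all_reals all_analysis.
Set Implicit Arguments.
Unset Strict Implicit.
Unset Printing Implicit Defensive.
Import Order.TTheory GRing.Theory Num.Theory.
Import numFieldNormedType.Exports.
Local Open Scope classical_set_scope.
Local Open Scope ring_scope.

(* Well-scoped de Bruijn syntax: the free variables of a [formula k] are
   indexed by 'I_k, and a quantifier binds index 0 of its body. *)
Inductive formula (k : nat) : Type :=
| FEq of 'I_k & 'I_k
| FU of 'I_k
| FC of 'I_k & 'I_k & 'I_k
| FNot of formula k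
| FAnd of formula k & formula k
| FOr of formula k & formula k
| FImp of formula k & formula k
| FEx of formula k.+1
| FAll of formula k.+1.

Definition sentence := formula 0.

Definition env_cons (T : Type) (k : nat) (x : T) (e : 'I_k -> T) (i : 'I_k.+1) : T :=
  if unlift ord0 i is Some j then e j else x.

Fixpoint sat (T : finType) (C : T -> T -> T -> bool) (U : T -> bool)
    (k : nat) (phi : formula k) : ('I_k -> T) -> bool :=
  match phi with
  | FEq i j => fun e => e i == e j
  | FU i => fun e => U (e i)
  | FC i j l => fun e => C (e i) (e j) (e l)
  | FNot f => fun e => ~~ sat C U f e
  | FAnd f g => fun e => sat C U f e && sat C U g e
  | FOr f g => fun e => sat C U f e || sat C U g e
  | FImp f g => fun e => sat C U f e ==> sat C U g e
  | FEx f => fun e => [exists x : T, sat C U f (env_cons x e)]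
  | FAll f => fun e => [forall x : T, sat C U f (env_cons x e)]
  end.

Definition no_vars (T : Type) (i : 'I_0) : T :=
  False_rect T (notF (ltn_ord i)).

(* [n] = {1, ..., n} is represented by 'I_n, that is by {0, ..., n-1}; the
   shift by one is an order isomorphism. *)
Definition circ (n : nat) (x y z : 'I_n) : bool :=
  [|| (x < y)%N && (y < z)%N, (y < z)%N && (z < x)%N
    | (z < x)%N && (x < y)%N].

Definition models (n : nat) (U : {ffun 'I_n -> bool}) (S : sentence) : bool :=
  sat (@circ n) U S (@no_vars 'I_n).

(* The law of n independent Bernoulli(q) variables: the point mass of U is
   q ^ #{x | U x} * (1 - q) ^ #{x | ~ U x}. *)
Definition pr_unary (R : realType) (n : nat) (q : R)
    (E : {ffun 'I_n -> bool} -> bool) : R :=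
  \sum_(U : {ffun 'I_n -> bool} | E U) \prod_(x < n) (if U x then q else 1 - q).

Definition pr_models (R : realType) (n : nat) (q : R) (S : sentence) : R :=
  pr_unary q (fun U : {ffun 'I_n -> bool} => models U S).

Definition zero_one_law (R : realType) (p : nat -> R) : Prop :=
  forall S : sentence,
    pr_models n (p n) S @[n --> \oo] --> (0 : R) \/
    pr_models n (p n) S @[n --> \oo] --> (1 : R).

(* f(n) << n^{-a} *)
Definition ll_pow (R : realType) (f : nat -> R) (a : R) : Prop :=
  f n / (n%:R `^ (- a)) @[n --> \oo] --> (0 : R).

(* n^{-a} << f(n), multiplied out because f may vanish: division by zero
   yields 0, so a quotient with denominator f n would accept f = 0. *)
Definition pow_ll (R : realType) (a : R) (f : nat -> R) : Prop :=
  f n * n%:R `^ a @[n --> \oo] --> +oo.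

(* Main.v *)
(* A subset of the cycle is a binary word read up to rotation.  By
   Ehrenfeucht-Fraisse games, the truth of a sentence S depends only on the
   class of the word in a finite aperiodic monoid M.  Cut a random word of
   length n into independent halves u and v.  If u, v, uv and vu all lie in one
   J-class, then uv is idempotent; the idempotents of a J-class are conjugate,
   hence rotations of each other, so S has a constant truth value on them.

   It remains to see that the J-class of a random word is asymptotically
   deterministic, that is, that every ideal I of M contains it with probability
   tending to 0 or 1.  Let T(p) be the expected time at which a random word
   enters I.  Starting from a nonempty prefix only helps, so
   P(in I at time n) <= n / T(p) and P(not in I at time n) <= T(p) / n.  T is a
   rational function of p, so T(p) has the order of p^(-a) for an integer a, and
   the threshold cannot fall between n^(-1/k) and n^(-1/(k+1)).  In case (iii)
   every fixed word occurs, so every ideal is entered.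

   Conversely "some k consecutive elements lie in U" has a limit probability 0
   or 1 only if n p^k tends to 0 or to infinity, the upper bound on its
   probability coming from Harris' inequality. *)
Require Import Defs.
From HB Require Import structures.
From mathcomp Require Import all_boot all_order all_algebra.
From mathcomp Require Import all_classical all_reals all_analysis.
From mathcomp Require Import zify ring lra.
Set Implicit Arguments.
Unset Strict Implicit.
Unset Printing Implicit Defensive.
Import Order.TTheory GRing.Theory Num.Theory.
Import numFieldNormedType.Exports.
Local Open Scope classical_set_scope.
Local Open Scope ring_scope.

(** * Types of words *)

(** A finite type at every rank: this makes the monoid of types finite, so that union bounds can
    range over all its elements. *)
Fixpoint tp_space (A : finType) (r : nat) : finType :=
  if r is r'.+1 then {set (tp_space A r' * A * tp_space A r')%type} : finType else unit.

(* A move of the Ehrenfeucht-Fraisse game on words splits it into two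
   independent games, on the letters before and after the chosen position. *)
Fixpoint tp (A : finType) (r : nat) (w : seq A) : tp_space A r :=
  match r with
  | 0 => tt
  | r'.+1 => [set (tp r' (take i w), tnth (in_tuple w) i, tp r' (drop i.+1 w))
               | i : 'I_(size w)]%SET
  end.

Lemma tpS_mem (A : finType) r (w : seq A) (x : tp_space A r * A * tp_space A r) :
  reflect (exists a y b, w = a ++ y :: b /\ x = (tp r a, y, tp r b))
    (x \in (tp r.+1 w : {set _})).
Proof.
apply: (iffP imsetP) => [[i _ ->]|[a [y [b [-> ->]]]]].
  exists (take i w), (tnth (in_tuple w) i), (drop i.+1 w); split=> //.
  rewrite (tnth_nth (tnth (in_tuple w) i)) -drop_nth ?cat_take_drop //.
have lt_a : (size a < size (a ++ y :: b))%N by rewrite size_cat /= -addSnnS leq_addr.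
exists (Ordinal lt_a) => //; rewrite (tnth_nth y) /= nth_cat ltnn subnn /=.
by rewrite take_size_cat // drop_cat ltnNge leqnSn /= subSn // subnn /= drop0.
Qed.

(** One half of the back-and-forth condition: a move in [w] is answered in [w'], leaving [r] rounds
    on each side of the chosen letter. *)
Definition tp_sim (A : finType) r (w w' : seq A) : Prop :=
  forall a y b, w = a ++ y :: b ->
  exists a' b', [/\ w' = a' ++ y :: b', tp r a = tp r a' & tp r b = tp r b'].

Lemma tpS_eqP (A : finType) r (w w' : seq A) :
  tp r.+1 w = tp r.+1 w' <-> tp_sim r w w' /\ tp_sim r w' w.
Proof.
have half (u v : seq A) : tp r.+1 u = tp r.+1 v -> tp_sim r u v.
  move=> e a y b u_ayb.
  have: (tp r a, y, tp r b) \in (tp r.+1 u : {set _}) by apply/tpS_mem; exists a, y, b.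
  by rewrite e => /tpS_mem[a' [y' [b' [-> [-> -> ->]]]]]; exists a', b'.
have sub (u v : seq A) x : tp_sim r u v ->
    x \in (tp r.+1 u : {set _}) -> x \in (tp r.+1 v : {set _}).
  move=> uv /tpS_mem[a [y [b [/uv[a' [b' [-> -> ->]]] ->]]]].
  by apply/tpS_mem; exists a', y, b'.
split=> [e|[uv vu]]; first by split; apply: half.
by apply/setP => x; apply/idP/idP; apply: sub.
Qed.

Lemma tpS_sim (A : finType) r (w w' : seq A) : tp r.+1 w = tp r.+1 w' -> tp_sim r w w'.
Proof. by case/tpS_eqP. Qed.

Lemma tp_pred (A : finType) r (w w' : seq A) : tp r.+1 w = tp r.+1 w' -> tp r w = tp r w'.
Proof.
elim: r w w' => // r IH w w' /tpS_eqP[ww' w'w]; apply/tpS_eqP.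
split=> a y b.
  by move=> /ww'[a' [b' [-> /IH ? /IH ?]]]; exists a', b'.
by move=> /w'w[a' [b' [-> /IH ? /IH ?]]]; exists a', b'.
Qed.

Lemma tp_leq (A : finType) r r' (w w' : seq A) :
  (r' <= r)%N -> tp r w = tp r w' -> tp r' w = tp r' w'.
Proof.
move=> /subnK <-; elim: (r - r')%N => // d IH e.
by apply/IH/tp_pred.
Qed.

Lemma cat_eq_cat_cons (A : Type) (u v a b : seq A) y : u ++ v = a ++ y :: b ->
  (exists c, u = a ++ y :: c /\ b = c ++ v) \/
  (exists c, a = u ++ c /\ v = c ++ y :: b).
Proof.
elim: u a => [|x u IH] a /=; first by right; exists a.
case: a => [|z a] /= [-> e]; first by left; exists u.
by case: (IH _ e) => -[c [-> ->]]; [left|right]; exists c.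
Qed.

(** The games on the two factors are played side by side. A move falls in one factor and is answered
    there, while the other factor merely loses a round. *)
Lemma tp_cat (A : finType) r (u u' v v' : seq A) :
  tp r u = tp r u' -> tp r v = tp r v' -> tp r (u ++ v) = tp r (u' ++ v').
Proof.
elim: r u u' v v' => // r IH.
have sim (u u' v v' : seq A) : tp r.+1 u = tp r.+1 u' -> tp r.+1 v = tp r.+1 v' ->
    tp_sim r (u ++ v) (u' ++ v').
  move=> eu ev a y b e; case: (cat_eq_cat_cons e) => -[c [c1 c2]].
    have [a' [c' [-> ea ec]]] := tpS_sim eu c1.
    exists a', (c' ++ v'); rewrite -catA /= c2; split=> //.
    exact/IH/tp_pred.
  have [c' [b' [-> ec eb]]] := tpS_sim ev c2.
  exists (u' ++ c'), b'; rewrite -catA c1; split=> //.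
  by apply: IH => //; apply: tp_pred.
by move=> u u' v v' eu ev; apply/tpS_eqP; split; apply: sim.
Qed.

Lemma map_eq_cat_cons (A B : Type) (f : A -> B) s a y b : map f s = a ++ y :: b ->
  exists s1 x s2, [/\ s = s1 ++ x :: s2, a = map f s1, y = f x & b = map f s2].
Proof.
elim: s a => [|x s IH] [|z a] //= [<-].
  by move=> <-; exists [::], x, s.
by move=> /IH[s1 [x' [s2 [-> -> -> ->]]]]; exists (x :: s1), x', s2.
Qed.

Lemma tp_map (A B : finType) (f : A -> B) r (w w' : seq A) :
  tp r w = tp r w' -> tp r (map f w) = tp r (map f w').
Proof.
elim: r w w' => // r IH.
have sim (w w' : seq A) : tp r.+1 w = tp r.+1 w' -> tp_sim r (map f w) (map f w').
  move=> e a y b /= em; have [s1 [x [s2 [e0 -> -> ->]]]] := map_eq_cat_cons em.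
  have [s1' [s2' [-> e1 e2]]] := tpS_sim e e0.
  by exists (map f s1'), (map f s2'); rewrite map_cat; split=> //; apply: IH.
by move=> w w' e; apply/tpS_eqP; split; apply: sim.
Qed.

Definition wpow (A : Type) (w : seq A) n := flatten (nseq n w).

Lemma wpow_eq_cat_cons (A : Type) (w : seq A) n a y b : wpow w n = a ++ y :: b ->
  exists i j c d, [/\ n = (i + j).+1, w = c ++ y :: d, a = wpow w i ++ c & b = d ++ wpow w j].
Proof.
elim: n a => [|n IH] a /=; first by case: a.
move=> e; case: (cat_eq_cat_cons e) => -[c [-> e2]].
  by exists 0, n, a, c.
have [i [j [c' [d [-> ew -> eb]]]]] := IH _ e2.
by exists i.+1, j, c', d; rewrite /wpow /= catA.
Qed.

Lemma wpowD (A : Type) (w : seq A) i j : wpow w (i + j) = wpow w i ++ wpow w j.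
Proof. by rewrite /wpow nseqD flatten_cat. Qed.

(** This is the source of aperiodicity. A move inside one copy of [w] leaves powers [i] and [j] on
    its two sides; they cannot both lie below the threshold 2^r - 1. A short side is copied exactly
    and the other side stays above the threshold. *)
Lemma tp_wpow (A : finType) r (w : seq A) n m :
  (2 ^ r <= n.+1)%N -> (2 ^ r <= m.+1)%N -> tp r (wpow w n) = tp r (wpow w m).
Proof.
elim: r n m => // r IH.
suff sim n m : (2 ^ r.+1 <= n.+1)%N -> (2 ^ r.+1 <= m.+1)%N ->
    tp_sim r (wpow w n) (wpow w m).
  by move=> n m nr mr; apply/tpS_eqP; split; apply: sim.
move=> nr mr a y b ea; have [i [j [c [d [en ew -> ->]]]]] := wpow_eq_cat_cons ea.
suff [i' [j' [em ei ej]]] : exists i' j', [/\ m = (i' + j').+1,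
    tp r (wpow w i) = tp r (wpow w i') & tp r (wpow w j) = tp r (wpow w j')].
  exists (wpow w i' ++ c), (d ++ wpow w j'); split; try exact: tp_cat.
  by rewrite em -addnS wpowD /wpow /= -/(wpow w j') {2}ew -!catA.
rewrite expnS in nr mr; have r_gt0 : (0 < 2 ^ r)%N by rewrite expn_gt0.
have [lei|lti] := leqP (2 ^ r) i.+1; last first.
  by exists i, (m - i.+1)%N; split=> //; [lia|apply: IH; lia].
have [lej|ltj] := leqP (2 ^ r) j.+1; last first.
  by exists (m - j.+1)%N, j; split=> //; [lia|apply: IH; lia].
by exists (2 ^ r).-1, (m - 2 ^ r)%N; split; [lia|apply: IH; lia|apply: IH; lia].
Qed.

Lemma tp_has (A : finType) r (p : pred A) (w w' : seq A) :
  tp r.+1 w = tp r.+1 w' -> has p w = has p w'.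
Proof.
have half (u v : seq A) : tp_sim r u v -> has p u -> has p v.
  move=> uv /hasP[x xu px]; case/splitPr: xu uv => a b uv.
  by have [a' [b' [-> _ _]]] := uv a x b erefl; rewrite has_cat /= px orbT.
by case/tpS_eqP=> /half ? /half ?; apply/idP/idP.
Qed.

Definition precedes (A : Type) (p q : pred A) (w : seq A) : Prop :=
  exists a x b, [/\ w = a ++ x :: b, p x & has q b].

Lemma tp_precedes (A : finType) r (p q : pred A) (w w' : seq A) :
  tp r.+2 w = tp r.+2 w' -> precedes p q w -> precedes p q w'.
Proof.
move=> e [a [x [b [e0 px qb]]]]; have [a' [b' [-> _ /tp_has eb]]] := tpS_sim e e0.
by exists a', x, b'; rewrite -eb.
Qed.

(** * From games on marked words to satisfaction of formulas *)

Definition letter k : finType := ({ffun 'I_k -> bool} * bool)%type.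

Section Marked.
Variables (n k : nat).

(* The word of [U] where each letter also records which variables sit there. *)
Definition marked (U : 'I_n -> bool) (e : 'I_k -> 'I_n) :
    seq (letter k) :=
  [seq ([ffun j => e j == i], U i) | i <- enum 'I_n].

Lemma has_marked U e (p : pred (letter k)) :
  has p (marked U e) = [exists i, p ([ffun j => e j == i], U i)].
Proof.
rewrite has_map; apply/hasP/existsP => [[i _ pi]|[i pi]]; exists i => //.
by rewrite mem_enum.
Qed.
End Marked.

Lemma enum_ord_split n (i : 'I_n) :
  exists s1 s2, [/\ enum 'I_n = s1 ++ i :: s2, (forall j, (j \in s1) = (j < i)%N) &
    (forall j, (j \in s2) = (i < j)%N)].
Proof.
have: sorted ltn (map val (enum 'I_n)) by rewrite val_enum_ord iota_ltn_sorted.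
have := mem_enum 'I_n; have: i \in enum 'I_n by rewrite mem_enum.
case/splitPr: (enum 'I_n) / => s1 s2 mem_s.
rewrite (sorted_pairwise ltn_trans) map_cat pairwise_cat /= allrel_consr.
move=> /and3P[/andP[/allP s1i _] _ /andP[/allP s2i _]].
have s1P j : j \in s1 -> (j < i)%N by move=> js; apply/s1i/map_f.
have s2P j : j \in s2 -> (i < j)%N by move=> js; apply/s2i/map_f.
exists s1, s2; split=> // j; have := mem_s j; rewrite !inE mem_cat inE => mem_j.
  apply/idP/idP => [/s1P//|ji]; case/or3P: mem_j => //.
    by move=> /eqP ej; rewrite ej ltnn in ji.
  by move=> /s2P; rewrite ltnNge (ltnW ji).
apply/idP/idP => [/s2P//|ji]; case/or3P: mem_j => //.
  by move=> /s1P; rewrite ltnNge (ltnW ji).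
by move=> /eqP ej; rewrite ej ltnn in ji.
Qed.

Lemma enum_ord_split_uniq n (i : 'I_n) s1 s2 : enum 'I_n = s1 ++ i :: s2 ->
  (forall j, (j \in s1) = (j < i)%N) /\ (forall j, (j \in s2) = (i < j)%N).
Proof.
move=> es; have [t1 [t2 [et t1P t2P]]] := enum_ord_split i.
have := enum_uniq 'I_n; rewrite {1}es cat_uniq /= => /and3P[_ /norP[is1 _] _].
have := enum_uniq 'I_n; rewrite {1}et cat_uniq /= => /and3P[_ /norP[it1 _] _].
have st : size s1 = size t1.
  transitivity (index i (enum 'I_n)); first by rewrite es index_cat (negPf is1) /= eqxx addn0.
  by rewrite et index_cat (negPf it1) /= eqxx addn0.
by move/eqP: et; rewrite es eqseq_cat // eqseq_cons => /and3P[/eqP-> _ /eqP->].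
Qed.

Fixpoint qdepth k (phi : formula k) : nat :=
  match phi with
  | FEq _ _ | FU _ | FC _ _ _ => 0
  | FNot f => qdepth f
  | FAnd f g | FOr f g | FImp f g => maxn (qdepth f) (qdepth g)
  | FEx f | FAll f => (qdepth f).+1
  end.

(** Going under a quantifier shifts the old indices by one; [b] tells whether the new variable 0
    sits at this letter. *)
Definition mark_shift k (b : bool) (x : letter k) : letter k.+1 :=
  ([ffun j => if unlift ord0 j is Some j' then x.1 j' else b], x.2).

Lemma marked_env_cons n k (U : 'I_n -> bool) (e : 'I_k -> 'I_n) y s1 s2 :
  enum 'I_n = s1 ++ y :: s2 ->
  let F i : letter k := ([ffun j => e j == i], U i) in
  marked U (env_cons y e) =
    map (mark_shift false) (map F s1) ++ mark_shift true (F y) ::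
    map (mark_shift false) (map F s2).
Proof.
move=> es F; have [s1P s2P] := enum_ord_split_uniq es.
have shiftP i : ([ffun j => env_cons y e j == i], U i) = mark_shift (y == i) (F i).
  congr (_, _); apply/ffunP => j; rewrite !ffunE /env_cons.
  by case: unliftP => //= j' _; rewrite ffunE.
rewrite /marked es map_cat /= shiftP eqxx -!map_comp; congr (_ ++ _ :: _).
  apply/eq_in_map => i /=; rewrite s1P => lt_iy; rewrite shiftP.
  by case: eqP lt_iy => // ->; rewrite ltnn.
apply/eq_in_map => i /=; rewrite s2P => lt_iy; rewrite shiftP.
by case: eqP lt_iy => // ->; rewrite ltnn.
Qed.

Lemma precedes_marked n k (U : 'I_n -> bool) (e : 'I_k -> 'I_n) i j :
  reflect (precedes (fun x : letter k => x.1 i) (fun x : letter k => x.1 j) (marked U e))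
    (e i < e j)%N.
Proof.
apply: (iffP idP) => [lt_ij|[a [x [b [em xi jb]]]]].
  have [s1 [s2 [es _ s2P]]] := enum_ord_split (e i).
  rewrite /marked es map_cat /=; eexists _, _, _; split; first by [].
    by rewrite ffunE eqxx.
  rewrite has_map; apply/hasP; exists (e j); first by rewrite s2P.
  by rewrite /= ffunE eqxx.
have [s1 [y [s2 [es _ ex eb]]]] := map_eq_cat_cons em.
have [_ s2P] := enum_ord_split_uniq es.
move: xi; rewrite ex ffunE => /eqP->.
by move: jb; rewrite eb has_map => /hasP[z zs]; rewrite /= ffunE => /eqP->; rewrite -s2P.
Qed.

(** Each quantifier costs one round. The two extra rounds serve the atoms: to compare positions, one
    move picks the letter of the first variable and another looks for the second variable to its
    right. *)
Lemma sat_tp k (phi : formula k) n n' U U' (e : 'I_k -> 'I_n) (e' : 'I_k -> 'I_n') r :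
  ((qdepth phi).+2 <= r)%N -> tp r (marked U e) = tp r (marked U' e') ->
  sat (@circ n) U phi e = sat (@circ n') U' phi e'.
Proof.
have hasE k' r' n1 n2 U1 U2 (e1 : 'I_k' -> 'I_n1) (e2 : 'I_k' -> 'I_n2) p :
    (2 <= r')%N -> tp r' (marked U1 e1) = tp r' (marked U2 e2) ->
    has p (marked U1 e1) = has p (marked U2 e2).
  by move=> r2 /(tp_leq r2)/tp_has->.
have ltE k' r' n1 n2 U1 U2 (e1 : 'I_k' -> 'I_n1) (e2 : 'I_k' -> 'I_n2) i j :
    (2 <= r')%N -> tp r' (marked U1 e1) = tp r' (marked U2 e2) ->
    (e1 i < e1 j)%N = (e2 i < e2 j)%N.
  move=> r2 /(tp_leq r2) e12; apply/(precedes_marked U1)/(precedes_marked U2).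
    exact: tp_precedes e12.
  exact: tp_precedes (esym e12).
elim: phi n n' U U' e e' r => /=.
- move=> {}k i j n n' U U' e e' r r2 ee.
  have lt a b := ltE _ _ _ _ _ _ _ _ a b r2 ee.
  rewrite -(inj_eq val_inj (e i)) -(inj_eq val_inj (e' i)) /=.
  (* Equality is read off the order: two positions differ when one precedes the other. *)
  by apply: negb_inj; rewrite !neq_ltn !lt.
- move=> {}k i n n' U U' e e' r r2 ee.
  have := hasE _ _ _ _ _ _ _ _ (fun x : letter k => x.1 i && x.2) r2 ee.
  have E m V (f : 'I_k -> 'I_m) : has (fun x : letter k => x.1 i && x.2) (marked V f) = V (f i).
    rewrite has_marked; apply/existsP/idP => [[x]|Vf]; last by exists (f i); rewrite ffunE eqxx.
    by rewrite ffunE => /andP[/eqP->].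
  by rewrite !E.
- move=> {}k i j l n n' U U' e e' r r2 ee.
  have lt a b := ltE _ _ _ _ _ _ _ _ a b r2 ee.
  by rewrite /circ !lt.
- by move=> {}k f IH n n' U U' e e' r r2 ee; rewrite (IH _ _ _ _ _ _ _ r2 ee).
- move=> {}k f IHf g IHg n n' U U' e e' r; rewrite -!maxnSS geq_max => /andP[rf rg] ee.
  by rewrite (IHf _ _ _ _ _ _ _ rf ee) (IHg _ _ _ _ _ _ _ rg ee).
- move=> {}k f IHf g IHg n n' U U' e e' r; rewrite -!maxnSS geq_max => /andP[rf rg] ee.
  by rewrite (IHf _ _ _ _ _ _ _ rf ee) (IHg _ _ _ _ _ _ _ rg ee).
- move=> {}k f IHf g IHg n n' U U' e e' r; rewrite -!maxnSS geq_max => /andP[rf rg] ee.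
  by rewrite (IHf _ _ _ _ _ _ _ rf ee) (IHg _ _ _ _ _ _ _ rg ee).
all: move=> {}k f IH n n' U U' e e' [//|r] r2 ee.
(* Both quantifiers use this transfer of one move. The answering letter has the same mark and equal
   types on either side, so placing the new variable on it keeps the marked words equivalent. *)
all: have move_to n1 n2 U1 U2 (e1 : 'I_k -> 'I_n1) (e2 : 'I_k -> 'I_n2) :
    tp r.+1 (marked U1 e1) = tp r.+1 (marked U2 e2) -> forall y, exists y',
    sat (@circ n1) U1 f (env_cons y e1) = sat (@circ n2) U2 f (env_cons y' e2);
  [ move=> e12 y; have [s1 [s2 [es _ _]]] := enum_ord_split y;
    have em : marked U1 e1 = _ := congr1 (map _) es; rewrite map_cat /= in em;
    have [a' [b' [em' ea eb]]] := tpS_sim e12 em;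
    have [t1 [y' [t2 [et ea' ey eb']]]] := map_eq_cat_cons em';
    exists y'; apply: (IH _ _ _ _ _ _ r r2);
    rewrite (marked_env_cons _ _ es) (marked_env_cons _ _ et);
    apply: tp_cat; [by apply: tp_map; rewrite ea ea'|];
    rewrite -cat1s -[in RHS]cat1s; apply: tp_cat; [by rewrite ey|by apply: tp_map; rewrite eb eb']
  | ].
- apply/existsP/existsP => -[y]; first by have [y' ->] := move_to _ _ _ _ _ _ ee y; exists y'.
  by have [y' ->] := move_to _ _ _ _ _ _ (esym ee) y; exists y'.
- apply/forallP/forallP => sat_all y.
    by have [y' ->] := move_to _ _ _ _ _ _ (esym ee) y.
  by have [y' ->] := move_to _ _ _ _ _ _ ee y.
Qed.

(** * The syntactic monoid and Green's relations *)

Definition word n (U : 'I_n -> bool) : seq bool := [seq U i | i <- enum 'I_n].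

Definition modw (S : sentence) (w : seq bool) : bool :=
  sat (@circ (size w)) (tnth (in_tuple w)) S (@no_vars 'I_(size w)).

Lemma word_tnth (w : seq bool) : word (tnth (in_tuple w)) = w.
Proof. by rewrite /word map_tnth_enum. Qed.

Lemma marked_word n (U : 'I_n -> bool) (e : 'I_0 -> 'I_n) :
  marked U e = [seq ([ffun _ => false], b) | b <- word U].
Proof.
rewrite /marked /word -map_comp; apply: eq_map => i /=; congr (_, _).
by apply/ffunP => -[].
Qed.

Lemma sat_word (S : sentence) n n' (U : 'I_n -> bool) (U' : 'I_n' -> bool) r :
  ((qdepth S).+2 <= r)%N -> tp r (word U) = tp r (word U') ->
  sat (@circ n) U S (@no_vars _) = sat (@circ n') U' S (@no_vars _).
Proof. by move=> Sr e; apply: (sat_tp Sr); rewrite !marked_word; apply: tp_map. Qed.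

Lemma models_word n (U : {ffun 'I_n -> bool}) S : models U S = modw S (word U).
Proof. by apply: (@sat_word _ _ _ _ _ (qdepth S).+2) => //; rewrite word_tnth. Qed.

Lemma modw_tp (S : sentence) r (w w' : seq bool) :
  ((qdepth S).+2 <= r)%N -> tp r w = tp r w' -> modw S w = modw S w'.
Proof. by move=> Sr e; apply: (sat_word Sr); rewrite !word_tnth. Qed.

Lemma sat_iso (T T' : finType) (C : T -> T -> T -> bool) (C' : T' -> T' -> T' -> bool)
    (U : T -> bool) (U' : T' -> bool) (f : T -> T') (g : T' -> T) :
  cancel f g -> cancel g f ->
  (forall x y z, C' (f x) (f y) (f z) = C x y z) -> (forall x, U' (f x) = U x) ->
  forall k (phi : formula k) (e : 'I_k -> T), sat C' U' phi (f \o e) = sat C U phi e.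
Proof.
move=> fK gK fC fU k phi; elim: phi => {k}.
- by move=> k i j e /=; rewrite (can_eq fK).
- by move=> k i e /=.
- by move=> k i j l e /=.
- by move=> k F IH e /=; rewrite IH.
- by move=> k F IHF G IHG e /=; rewrite IHF IHG.
- by move=> k F IHF G IHG e /=; rewrite IHF IHG.
- by move=> k F IHF G IHG e /=; rewrite IHF IHG.
all: move=> k F IH e /=; have consE x : env_cons (f x) (f \o e) = f \o env_cons x e;
  [ by apply: funext => i; rewrite /env_cons /=; case: (unlift _ _) | ].
- apply/existsP/existsP => -[x satx]; last by exists (f x); rewrite consE IH.
  by exists (g x); rewrite -IH -consE gK.
- apply/forallP/forallP => satx x; first by rewrite -IH -consE.
  by rewrite -[x]gK consE IH.
Qed.

(** A rotation of positions preserves [circ], so the two words carry isomorphic structures. *)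
Lemma modw_catC (S : sentence) (u v : seq bool) : modw S (u ++ v) = modw S (v ++ u).
Proof.
suff [f [g [fK gK fC fU]]] : exists (f : 'I_(size (u ++ v)) -> 'I_(size (v ++ u))) g,
    [/\ cancel f g, cancel g f,
      forall x y z, circ (f x) (f y) (f z) = circ x y z &
      forall x, tnth (in_tuple (v ++ u)) (f x) = tnth (in_tuple (u ++ v)) x].
  by rewrite /modw -(sat_iso fK gK fC fU); congr (sat _ _ _ _); apply: funext => -[].
pose rot a b i := (if i < a then i + b else i - a)%N.
have rotP (s t : seq bool) (i : 'I_(size (s ++ t))) :
    (rot (size s) (size t) i < size (t ++ s))%N.
  by case: i => i; rewrite /rot /= !size_cat => lt_i; case: ifP => ?; lia.
pose F (s t : seq bool) i := Ordinal (rotP s t i).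
have FK (s t : seq bool) : cancel (F s t) (F t s).
  move=> [i lt_i]; apply: val_inj; rewrite /F /rot /=.
  move: lt_i; rewrite size_cat => lt_i; case: (ltnP i) => ?; case: ltnP => ?; lia.
exists (F u v), (F v u); split=> //.
  move=> [x lx] [y ly] [z lz]; rewrite /circ /F /rot /=.
  rewrite !size_cat in lx ly lz.
  by case: (ltnP x); case: (ltnP y); case: (ltnP z) => ? ? ?; apply/idP/idP; lia.
move=> [i lt_i]; rewrite !(tnth_nth false) /F /rot /= !nth_cat.
rewrite size_cat in lt_i; case: (ltnP i) => ui; first by rewrite ltnNge leq_addl addnK.
by rewrite ifT //; lia.
Qed.

(** Only realised types are kept, so that every element has a representative word. Products are
    computed on chosen representatives, and [tp_cat] makes the choice harmless. *)
Definition tp_class (r : nat) : Type := {x : tp_space bool r | `[< exists w, tp r w = x >]}.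

HB.instance Definition _ r := Finite.on (tp_class r).

Fact tp_in_class r (w : seq bool) : `[< exists w', tp r w' = tp r w >].
Proof. by apply/asboolP; exists w. Qed.

Definition class r (w : seq bool) : tp_class r := exist _ (tp r w) (tp_in_class r w).

Lemma class_eqP r (u v : seq bool) : class r u = class r v <-> tp r u = tp r v.
Proof. by split=> [/(congr1 val)|] e //; apply: val_inj. Qed.

Fact class_surj r (x : tp_class r) : exists w, class r w = x.
Proof. by have /asboolP[w ew] := valP x; exists w; apply: val_inj. Qed.

Definition class_rep r (x : tp_class r) : seq bool := projT1 (cid (class_surj x)).

Lemma class_repK r : cancel (@class_rep r) (class r).
Proof. by move=> x; rewrite /class_rep; case: (cid _). Qed.

Definition class_mul r (x y : tp_class r) := class r (class_rep x ++ class_rep y).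

Lemma class_cat r (u v : seq bool) : class r (u ++ v) = class_mul (class r u) (class r v).
Proof. by apply/class_eqP/tp_cat; apply/class_eqP; rewrite class_repK. Qed.

Fact class_mulA r : associative (@class_mul r).
Proof.
move=> x y z; rewrite -(class_repK x) -(class_repK y) -(class_repK z).
by rewrite -!class_cat catA.
Qed.

Fact class_mul1 r : left_id (class r [::]) (@class_mul r).
Proof. by move=> x; rewrite -(class_repK x) -class_cat. Qed.

Fact class_1mul r : right_id (class r [::]) (@class_mul r).
Proof. by move=> x; rewrite -(class_repK x) -class_cat cats0. Qed.

HB.instance Definition _ r :=
  isMonoid.Build (tp_class r) (@class_mulA r) (@class_mul1 r) (@class_1mul r).

Lemma classM r (u v : seq bool) : class r (u ++ v) = (class r u * class r v)%g.
Proof. exact: class_cat. Qed.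

Lemma class_wpow r w n : class r (wpow w n) = (class r w ^+ n)%g.
Proof. by elim: n => // n IH; rewrite expgS -IH -classM. Qed.

Definition aperiodic (M : monoidType) : Prop :=
  exists N : nat, forall x : M, (x ^+ N.+1 = x ^+ N)%g.

Lemma tp_class_aperiodic r : aperiodic (tp_class r).
Proof.
exists (2 ^ r)%N => x; rewrite -(class_repK x) -!class_wpow.
by apply/class_eqP/tp_wpow; lia.
Qed.

(** * Stability and trivial H-classes in aperiodic monoids *)

Section AperiodicMonoid.
Local Open Scope group_scope.
Variable M : monoidType.
Implicit Types x y z : M.

(** Green's J-preorder: [x] lies in the two-sided ideal generated by [y], so going down means going
    deeper into ideals. *)
Definition leJ x y := exists a b, x = a * y * b.

Definition eqJ x y := leJ x y /\ leJ y x.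

Lemma leJ_trans y x z : leJ x y -> leJ y z -> leJ x z.
Proof.
by move=> [a [b ->]] [c [d ->]]; exists (a * c), (d * b); rewrite !mulgA.
Qed.

Hypothesis M_aperiodic : aperiodic M.

(** Iterating gives x = a^N x b^N, and at the exponent N of aperiodicity one more factor [a] or [b]
    is absorbed. *)
Lemma aperiodic_fix a b x : x = a * x * b -> a * x = x /\ x * b = x.
Proof.
have [N apN] := M_aperiodic; move=> e.
have eN n : x = a ^+ n * x * b ^+ n.
  elim: n => [|n IH]; first by rewrite !expg0 mul1g mulg1.
  by rewrite {1}e {1}IH expgS expgSr !mulgA.
split; first by rewrite [in LHS](eN N) !mulgA -expgS apN -eN.
by rewrite [in LHS](eN N) -!mulgA -expgSr apN mulgA -eN.
Qed.

Lemma stable_right x a : leJ x (x * a) -> exists b, x = x * a * b.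
Proof.
move=> [c [d e]]; have e' : x = c * x * (a * d) by rewrite {1}e !mulgA.
by have [_ e2] := aperiodic_fix e'; exists d; rewrite -mulgA.
Qed.

Lemma stable_left x a : leJ x (a * x) -> exists b, x = b * (a * x).
Proof.
move=> [c [d e]]; have e' : x = (c * a) * x * d by rewrite {1}e !mulgA.
by have [e2 _] := aperiodic_fix e'; exists c; rewrite mulgA.
Qed.

(** Triviality of H-classes: x = t' x s forces x s = x by [aperiodic_fix]. *)
Lemma H_trivial x y s t t' : y = x * s -> y = t * x -> x = t' * y -> x = y.
Proof.
move=> ys yt xt; have e' : x = t' * x * s by rewrite -mulgA -ys.
by have [_ {1}<-] := aperiodic_fix e'.
Qed.

Lemma eqJ_sandwich u v : leJ v (v * u) -> leJ v (u * v) -> leJ u (v * u) -> v * u * v = v.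
Proof.
move=> /stable_right _ /stable_left[s vs] /stable_left[b ub]; apply: esym.
(* The element v u v is both a right and a left multiple of v. Conversely v = s (u v) and u = b (v
   u) give v = (s b)(v u v). *)
apply: (@H_trivial _ _ (u * v) (v * u) (s * b)); rewrite ?mulgA //.
by rewrite [LHS]vs {1}ub !mulgA.
Qed.

Lemma eqJ_idempotent u v :
  leJ v (v * u) -> leJ v (u * v) -> leJ u (v * u) -> (u * v) * (u * v) = u * v.
Proof. by move=> h1 h2 h3; rewrite -mulgA [v * _]mulgA eqJ_sandwich. Qed.

(** From e = s f t take a = e s f and b = f t e, so that a b = e. Since e = a (b a) b, the element b
    a is still J-above f, and stability with trivial H-classes identifies it with f. *)
Lemma eqJ_idempotent_conj e f : e * e = e -> f * f = f -> eqJ e f ->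
  exists a b, e = a * b /\ f = b * a.
Proof.
move=> ee ff [[s [t est]] fe].
have [a [b [eab aE bE]]] : exists a b, [/\ e = a * b, a = e * s * f & b = f * t * e].
  exists (e * s * f), (f * t * e); split=> //.
  by rewrite !mulgA -(mulgA (e * s)) ff -!mulgA (mulgA s) (mulgA (s * f)) -est !ee.
exists a, b; split=> //.
have baE : b * a = (f * t * e * s) * f by rewrite aE bE !mulgA -(mulgA (f * t)) ee.
have le_fba : leJ f (b * a).
  by apply: leJ_trans fe _; exists a, b; rewrite !mulgA -eab -mulgA -eab ee.
rewrite baE in le_fba; have [b' fb] := stable_left le_fba.
by rewrite baE; apply: (@H_trivial _ _ (t * e * s * f) (f * t * e * s) b'); first rewrite !mulgA.
Qed.

End AperiodicMonoid.

(** * J-classes and random words *)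

(** A J-class is described by the set [low] of elements it lies below. Each bit then concerns a
    single ideal and can be analysed separately. *)
Definition J_profile r (low : pred (tp_class r)) (w : seq bool) : bool :=
  [forall x, `[< leJ (class r w) x >] == low x].

Lemma J_profile_eqJ r low (u v : seq bool) :
  @J_profile r low u -> J_profile low v -> eqJ (class r u) (class r v).
Proof.
move=> /forallP lu /forallP lv.
have refl (x : tp_class r) : leJ x x by exists 1%g, 1%g; rewrite mul1g mulg1.
by split; apply/asboolP; [rewrite (eqP (lu _)) -(eqP (lv _))|rewrite (eqP (lv _)) -(eqP (lu _))];
  apply/asboolP.
Qed.

Lemma J_profile_idempotent r low (u v : seq bool) :
  @J_profile r low u -> J_profile low v -> J_profile low (u ++ v) ->
  J_profile low (v ++ u) ->
  (class r (u ++ v) * class r (u ++ v) = class r (u ++ v))%g.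
Proof.
move=> lu lv luv lvu; rewrite classM; apply: eqJ_idempotent; first exact: tp_class_aperiodic.
- by rewrite -classM; case: (J_profile_eqJ lv lvu).
- by rewrite -classM; case: (J_profile_eqJ lv luv).
- by rewrite -classM; case: (J_profile_eqJ lu lvu).
Qed.

Lemma modw_J_profile (S : sentence) r (low : pred (tp_class r)) :
  ((qdepth S).+2 <= r)%N ->
  exists theta : bool, forall u v, J_profile low u -> J_profile low v ->
    J_profile low (u ++ v) -> J_profile low (v ++ u) -> modw S (u ++ v) = theta.
Proof.
move=> Sr; pose good u v := [/\ J_profile low u, J_profile low v, J_profile low (u ++ v) &
  J_profile low (v ++ u)].
have [[u0 [v0 g0]]|none] := pselect (exists u v, good u v); last first.
  by exists true => u v ? ? ? ?; case: none; exists u, v.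
exists (modw S (u0 ++ v0)) => u v lu lv luv lvu; case: g0 => lu0 lv0 luv0 lvu0.
(* The classes of u v and u0 v0 are J-equivalent idempotents, hence of the form a b and b a. Up to
   type, the two words are therefore rotations of each other. *)
have [a [b []]] := eqJ_idempotent_conj (@tp_class_aperiodic r)
  (J_profile_idempotent lu lv luv lvu) (J_profile_idempotent lu0 lv0 luv0 lvu0)
  (J_profile_eqJ luv luv0).
rewrite -(class_repK a) -(class_repK b) -!classM => /class_eqP e1 /class_eqP e2.
by rewrite (modw_tp Sr e1) modw_catC (modw_tp Sr e2).
Qed.

(** * Expectations over random words *)

Section RandomWords.
Variables (R : realType).
Implicit Types (p : R) (n : nat) (F G : seq bool -> R) (E : pred (seq bool)).

(** Conditioning on the letters one by one builds in independence, so cutting a word into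
    independent parts becomes a mere induction; [sum_unary_expect] identifies this with the sum over
    subsets. *)
Fixpoint expect p n F : R :=
  if n is n'.+1 then p * expect p n' (fun w => F (true :: w)) +
                     (1 - p) * expect p n' (fun w => F (false :: w))
  else F [::].

Definition prob p n E : R := expect p n (fun w => (E w)%:R).

Lemma word_cons n (b : bool) (V : 'I_n -> bool) :
  word (fun i : 'I_n.+1 => if unlift ord0 i is Some j then V j else b) = b :: word V.
Proof.
rewrite /word enum_ordSl /= unlift_none -map_comp; congr (_ :: _).
by apply: eq_map => j /=; rewrite liftK.
Qed.

Lemma sum_unary_expect p n F :
  \sum_(U : {ffun 'I_n -> bool}) F (word U) * \prod_(x < n) (if U x then p else 1 - p)
  = expect p n F.
Proof.
elim: n F => [|n IH] F.
  rewrite (eq_bigr (fun _ => F [::])) => [|U _].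
    by rewrite sumr_const card_ffun card_ord expn0 mulr1n.
  by rewrite big_ord0 mulr1 /word enum_ord0.
pose h (x : bool * {ffun 'I_n -> bool}) : {ffun 'I_n.+1 -> bool} :=
  [ffun i => if unlift ord0 i is Some j then x.2 j else x.1].
have h_word b V : word (h (b, V)) = b :: word V.
  by rewrite -word_cons; apply: eq_map => i; rewrite ffunE.
have h_bij : bijective h.
  exists (fun U : {ffun 'I_n.+1 -> bool} => (U ord0, [ffun j => U (lift ord0 j)])) => [[b V]|U].
    rewrite /h ffunE unlift_none; congr (_, _); apply/ffunP => j.
    by rewrite !ffunE liftK.
  by apply/ffunP => i; rewrite !ffunE; case: unliftP => [j|] -> //; rewrite ffunE.
rewrite (reindex h) /=; last exact: onW_bij.
rewrite (eq_bigr (fun x : bool * {ffun 'I_n -> bool} =>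
    F (x.1 :: word x.2) * ((if x.1 then p else 1 - p) *
    \prod_(i < n) (if x.2 i then p else 1 - p)))) => [|[b V] _]; last first.
  rewrite h_word big_ord_recl ffunE unlift_none; congr (_ * (_ * _)).
  by apply: eq_bigr => i _; rewrite ffunE liftK.
rewrite -(pair_bigA _ (fun b (V : {ffun 'I_n -> bool}) =>
    F (b :: word V) * ((if b then p else 1 - p) *
    \prod_(i < n) (if V i then p else 1 - p)))) /= big_bool /= -!IH !mulr_sumr.
by congr (_ + _); apply: eq_bigr => V _; rewrite mulrCA.
Qed.

Lemma pr_models_prob p n S : pr_models n p S = prob p n (modw S).
Proof.
rewrite /pr_models /pr_unary /prob -sum_unary_expect big_mkcond /=.
by apply: eq_bigr => U _; rewrite models_word; case: modw; rewrite ?mul1r ?mul0r.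
Qed.

Lemma eq_expect p n F G : (forall w, size w = n -> F w = G w) -> expect p n F = expect p n G.
Proof.
elim: n F G => [|n IH] F G FG /=; first exact: FG.
have cons b : expect p n (fun w => F (b :: w)) = expect p n (fun w => G (b :: w)).
  by apply: IH => w sw; apply: FG; rewrite /= sw.
by rewrite !cons.
Qed.

Lemma expectD p n F G : expect p n (fun w => F w + G w) = expect p n F + expect p n G.
Proof. by elim: n F G => [|n IH] F G //=; rewrite !IH; ring. Qed.

Lemma expectZ p n a F : expect p n (fun w => a * F w) = a * expect p n F.
Proof. by elim: n F => [|n IH] F //=; rewrite !IH; ring. Qed.

Lemma expect_cst p n a : expect p n (fun=> a) = a.
Proof. by elim: n => [|n IH] //=; rewrite IH; ring. Qed.

Lemma expect_cat p m n F :
  expect p (m + n) F = expect p m (fun u => expect p n (fun v => F (u ++ v))).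
Proof. by elim: m F => [|m IH] F //=; rewrite !IH. Qed.

Lemma expect_exchange p m n (F : seq bool -> seq bool -> R) :
  expect p m (fun u => expect p n (F u)) = expect p n (fun v => expect p m (F^~ v)).
Proof.
elim: m F => [|m IH] F //=.
by rewrite !IH -!expectZ -expectD.
Qed.

Lemma le_expect p n F G : 0 <= p <= 1 -> (forall w, size w = n -> F w <= G w) ->
  expect p n F <= expect p n G.
Proof.
move=> /andP[p0 p1]; elim: n F G => [|n IH] F G FG /=; first exact: FG.
by apply: lerD; apply: ler_wpM2l; rewrite ?subr_ge0 //; apply: IH => w sw; apply: FG;
  rewrite /= sw.
Qed.

Lemma prob_cat p m n E :
  prob p (m + n) E = expect p m (fun u => prob p n (fun v => E (u ++ v))).
Proof. exact: expect_cat. Qed.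

Lemma eq_prob p n E E' : (forall w, size w = n -> E w = E' w) -> prob p n E = prob p n E'.
Proof. by move=> EE'; apply: eq_expect => w /EE' ->. Qed.

Lemma prob_predC p n E : prob p n (predC E) = 1 - prob p n E.
Proof.
rewrite -[X in X - _](expect_cst p n) /prob -mulN1r -expectZ -expectD.
by apply: eq_expect => w _ /=; case: (E w) => /=; ring.
Qed.

Section Probability.
Variables (p : R) (p01 : 0 <= p <= 1).

Lemma le_prob n E E' : (forall w, size w = n -> E w -> E' w) -> prob p n E <= prob p n E'.
Proof.
move=> EE'; apply: le_expect => // w /EE'; rewrite ler_nat.
by case: (E w) => // ->.
Qed.

Lemma prob_ge0 n E : 0 <= prob p n E.
Proof. by rewrite -(expect_cst p n 0); apply: le_expect => // w _; rewrite ler0n. Qed.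

Lemma prob_le1 n E : prob p n E <= 1.
Proof. by rewrite -[leRHS](expect_cst p n); apply: le_expect => // w _; rewrite lern1 leq_b1. Qed.

Lemma prob_exists n (I : finType) (P : I -> pred (seq bool)) :
  prob p n (fun w => [exists i, P i w]) <= \sum_i prob p n (P i).
Proof.
have sumE (s : seq I) : expect p n (fun w => \sum_(i <- s) (P i w)%:R)
    = \sum_(i <- s) prob p n (P i).
  elim: s => [|i s IH].
    by rewrite big_nil -[RHS](expect_cst p n); apply: eq_expect => w _; rewrite big_nil.
  by rewrite big_cons -IH -expectD; apply: eq_expect => w _; rewrite big_cons.
rewrite -sumE; apply: le_expect => // w _.
have [/existsP[i Pi]|_] := boolP [exists i, P i w]; last exact: sumr_ge0.
by rewrite (bigD1 i) //= Pi lerDl sumr_ge0.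
Qed.

End Probability.
End RandomWords.

Lemma le_prob_addn (R : realType) (p : R) (p01 : 0 <= p <= 1) m n (E : pred (seq bool)) :
  (forall u v, E u -> E (u ++ v)) -> prob p m E <= prob p (m + n) E.
Proof.
move=> Ecat; rewrite prob_cat; apply: le_expect => // u _.
rewrite -(expect_cst p n (E u)%:R); apply: le_expect => // v _.
by rewrite ler_nat; have := Ecat u v; case: (E u) => // ->.
Qed.

Definition J_below r (x : tp_class r) (w : seq bool) : bool := `[< leJ (class r w) x >].

Lemma J_below_factor r (x : tp_class r) a w b : J_below x w -> J_below x (a ++ w ++ b).
Proof.
move=> /asboolP wx; apply/asboolP; apply: leJ_trans wx.
by exists (class r a), (class r b); rewrite !classM mulgA.
Qed.

Lemma J_below_catl r (x : tp_class r) a w : J_below x w -> J_below x (a ++ w).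
Proof. by move=> /(@J_below_factor _ _ a _ [::]); rewrite cats0. Qed.

Lemma J_below_catr r (x : tp_class r) w b : J_below x w -> J_below x (w ++ b).
Proof. exact: (@J_below_factor _ _ [::]). Qed.

(** * A zero-one criterion through J-classes *)

Section Criterion.
Variables (R : realType) (S : sentence) (r : nat) (low : pred (tp_class r)).
Hypothesis Sr : ((qdepth S).+2 <= r)%N.

(** Membership in an ideal only becomes likelier as the word grows. The worst length in [n/2, n] is
    thus n/2 if membership is expected and n if it is not, and one quantity controls all lengths in
    between. *)
Definition J_error (p : R) n x : R :=
  if low x then prob p n./2 (predC (J_below x)) else prob p n (J_below x).

Lemma prob_J_profileC (p : R) (p01 : 0 <= p <= 1) n l : (n./2 <= l <= n)%N ->
  prob p l (predC (J_profile low)) <= \sum_x J_error p n x.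
Proof.
move=> /andP[nl ln].
rewrite (eq_prob _ (E' := fun w => [exists x, J_below x w != low x])) => [|w _]; last first.
  by rewrite /= /J_profile negb_forall.
apply: le_trans (prob_exists p01 _ _) _; apply: ler_sum => x _; rewrite /J_error.
case: ifP => lowx.
  rewrite (eq_prob _ (E' := predC (J_below x))) => [|w _]; last by rewrite eqb_id.
  rewrite !prob_predC lerD2l lerN2 -(subnKC nl).
  by apply: le_prob_addn => // u v; apply: J_below_catr.
rewrite (eq_prob _ (E' := J_below x)) => [|w _]; last by rewrite eqbF_neg negbK.
by rewrite -(subnKC ln); apply: le_prob_addn => // u v; apply: J_below_catr.
Qed.

(** The factor 4 is a union bound over the words u, v, u v and v u, where u and v are the two
    halves. *)
Lemma prob_modw_near : exists theta : bool, forall (p : R) n, 0 <= p <= 1 ->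
  prob p n (fun w => modw S w != theta) <= 4 * \sum_x J_error p n x.
Proof.
have [theta good] := modw_J_profile low Sr; exists theta => p n p01.
pose bad w : R := (predC (J_profile low) w)%:R.
pose m := n./2; pose k := (n - m)%N.
have nE : n = (m + k)%N by rewrite /k /m; lia.
have bad_le l : (n./2 <= l <= n)%N -> expect p l bad <= \sum_x J_error p n x.
  exact: prob_J_profileC.
rewrite {1}nE prob_cat.
have good_bad u v : ((modw S (u ++ v) != theta)%:R : R) <=
    bad u + bad v + bad (u ++ v) + bad (v ++ u).
  rewrite /bad /= -!natrD ler_nat; have := good u v.
  case: (J_profile low u) => /=; last by case: (_ != theta).
  case: (J_profile low v) => /=; last by case: (_ != theta).
  case: (J_profile low (u ++ v)) => /=; last by case: (_ != theta).
  case: (J_profile low (v ++ u)) => /=; last by case: (_ != theta).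
  by move=> ->; rewrite ?eqxx.
apply: le_trans (le_expect p01 (fun u _ => le_expect p01 (fun v _ => good_bad u v))) _.
rewrite (eq_expect _ (G := fun u => bad u + expect p k bad + expect p k (fun v => bad (u ++ v))
      + expect p k (fun v => bad (v ++ u)))) => [|u _]; last by rewrite !expectD expect_cst.
  (* Drawing the halves in the other order shows that v u is also a random word of length n. *)
  rewrite !expectD expect_cst -expect_cat (expect_exchange p m k (fun u v => bad (v ++ u))).
  rewrite -expect_cat [(k + m)%N]addnC -nE.
  have := bad_le m; have := bad_le k; have := bad_le n; rewrite /k /m => b1 b2 b3.
  have := b1 ltac:(lia); have := b2 ltac:(lia); have := b3 ltac:(lia); rewrite /k /m; lra.
Qed.

Lemma modw_zero_one (p : nat -> R) : (\forall n \near \oo, 0 <= p n <= 1) ->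
  (forall x, J_error (p n) n x @[n --> \oo] --> (0 : R)) ->
  pr_models n (p n) S @[n --> \oo] --> (0 : R) \/
  pr_models n (p n) S @[n --> \oo] --> (1 : R).
Proof.
move=> p01 err; have [theta near_theta] := prob_modw_near.
have sum_seq (s : seq (tp_class r)) : \sum_(x <- s) J_error (p n) n x @[n --> \oo] --> (0 : R).
  elim: s => [|x s IH].
    by under eq_cvg do rewrite big_nil; apply: cvg_cst.
  have -> : (fun n => \sum_(y <- x :: s) J_error (p n) n y) =
      (fun n => J_error (p n) n x + \sum_(y <- s) J_error (p n) n y).
    by apply: funext => n; rewrite big_cons.
  have := cvgD (err x) IH; rewrite addr0; exact.
have sum0 : 4 * (\sum_x J_error (p n) n x) @[n --> \oo] --> (0 : R).
  rewrite -[X in _ --> X](mulr0 (4 : R)); apply: cvgM => //; exact: cvg_cst.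
have prob0 : prob (p n) n (fun w => modw S w != theta) @[n --> \oo] --> (0 : R).
  apply: (squeeze_cvgr _ (cvg_cst _) sum0); near=> n.
  have pn : 0 <= p n <= 1 by near: n.
  by rewrite prob_ge0 //= near_theta.
case: theta {near_theta} prob0 => prob0; [right|left].
  have : 1 - prob (p n) n (fun w => modw S w != true) @[n --> \oo] --> (1 : R).
    by rewrite -[X in _ --> X](subr0 (1 : R)); apply: cvgB => //; apply: cvg_cst.
  apply: cvg_trans; apply: near_eq_cvg; near=> n.
  rewrite pr_models_prob -prob_predC; apply: eq_prob => w _ /=.
  by case: modw.
move: prob0; apply: cvg_trans; apply: near_eq_cvg; near=> n.
by rewrite pr_models_prob; apply: eq_prob => w _ /=; case: modw.
Unshelve. all: by end_near.
Qed.

End Criterion.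

(** * Hitting times of factor-closed languages *)

Section FactorIdeal.
Variables (R : realType) (E : pred (seq bool)).
Hypothesis E_catr : forall u v, E u -> E (u ++ v).
Hypothesis E_catl : forall u v, E v -> E (u ++ v).
Implicit Types p : R.

Lemma prob_avoid_cat p m n : 0 <= p <= 1 ->
  prob p (m + n) (predC E) <= prob p m (predC E) * prob p n (predC E).
Proof.
move=> p01; rewrite prob_cat mulrC /prob -expectZ; apply: le_expect => // u _.
rewrite mulrC -expectZ; apply: le_expect => // v _; rewrite -natrM ler_nat /=.
have := @E_catr u v; have := @E_catl u v.
by case: (E (u ++ v)) => //; case: (E u) => [_ /(_ isT)|] //; case: (E v) => [/(_ isT)|].
Qed.

Lemma prob_avoid_anti p m n : 0 <= p <= 1 -> (m <= n)%N ->
  prob p n (predC E) <= prob p m (predC E).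
Proof.
move=> p01 /subnKC <-; rewrite !prob_predC lerD2l lerN2.
exact: le_prob_addn.
Qed.

(** Each of m independent blocks is hit with probability at least d, so avoidance costs at most (1 -
    d)^m <= 1 / (1 + m d). The product form avoids a division. *)
Lemma prob_avoid_exp p L m d : 0 <= p <= 1 -> 0 <= d -> d <= prob p L E ->
  prob p (m * L) (predC E) * (1 + m%:R * d) <= 1.
Proof.
move=> p01 d0 dE; have d1 : d <= 1 by apply: le_trans dE (prob_le1 p01 _ _).
have g_le : prob p (m * L) (predC E) <= (1 - d) ^+ m.
  elim: m => [|m IH]; first by rewrite expr0 prob_le1.
  rewrite mulSn exprS; apply: le_trans (prob_avoid_cat _ _ p01) _.
  by apply: ler_pM; rewrite ?prob_ge0 // prob_predC; lra.
apply: (@le_trans _ _ ((1 - d) ^+ m * (1 + m%:R * d))).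
  by apply: ler_wpM2r => //; rewrite addr_ge0 // mulr_ge0.
elim: m {g_le} => [|m IH]; first by rewrite expr0; lra.
rewrite exprS; set a := (1 - d) ^+ m in IH *.
have a0 : 0 <= a by rewrite exprn_ge0 // subr_ge0.
(* This is the slack in (1 - d)(1 + (m + 1) d) = 1 + m d - (m + 1) d^2. *)
have ad : 0 <= a * (d * d * m.+1%:R) by rewrite !mulr_ge0.
by move: ad; rewrite -!natr1; nra.
Qed.

Lemma prob_word_ge p m w : 0 <= m -> m <= p -> m <= 1 - p -> E w ->
  m ^+ size w <= prob p (size w) E.
Proof.
move=> m0 mp mq; rewrite /prob.
have p01 : 0 <= p <= 1 by lra.
move: E => E'; elim: w E' => [|b w IH] E' /=; first by rewrite expr0 => ->.
move=> Ew; have IHb := IH (fun w => E' (b :: w)) Ew.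
have ge0 b' : 0 <= expect p (size w) (fun w0 => (E' (b' :: w0))%:R).
  exact: (prob_ge0 p01 (size w) (fun w0 => E' (b' :: w0))).
have m0n : 0 <= m ^+ size w by rewrite exprn_ge0.
rewrite exprS; case: b Ew IHb => _ IHb; have := ge0 true; have := ge0 false; nra.
Qed.

End FactorIdeal.

(** * Expected hitting time of an absorbing set of an automaton *)

Section HittingTime.
Variables (R : realType) (Q : finType) (step : Q -> bool -> Q) (s0 : Q) (acc : pred Q).
Hypothesis acc_step : forall s b, acc s -> acc (step s b).
Hypothesis acc_start : forall s w, acc (foldl step s0 w) -> acc (foldl step s w).
Hypothesis acc_reach : exists w, acc (foldl step s0 w).
Implicit Types p : R.

Definition survive p n s : R := prob p n (fun w => ~~ acc (foldl step s w)).

Lemma acc_run s w : acc s -> acc (foldl step s w).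
Proof. by elim: w s => //= b w IH s /acc_step/IH. Qed.

Lemma survive_max p n s : 0 <= p <= 1 -> survive p n s <= survive p n s0.
Proof. by move=> p01; apply: le_prob => // w _; apply/contra/acc_start. Qed.

Let E w := acc (foldl step s0 w).

Let E_catr u v : E u -> E (u ++ v).
Proof. by rewrite /E foldl_cat; apply: acc_run. Qed.

Let E_catl u v : E v -> E (u ++ v).
Proof. by rewrite /E foldl_cat; apply: acc_start. Qed.

Lemma survive_small p e : 0 < p < 1 -> 0 < e ->
  exists N, forall n, (N <= n)%N -> survive p n s0 < e.
Proof.
move=> p01 e0; have p01' : 0 <= p <= 1 by lra.
have [w Ew] := acc_reach; pose m := Num.min p (1 - p).
have [mp mq] : m <= p /\ m <= 1 - p by rewrite !ge_min !lexx orbT.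
have m0 : 0 < m by rewrite lt_min; lra.
pose d := m ^+ size w; have d0 : 0 < d by rewrite exprn_gt0.
have dE := @prob_word_ge R E p m w (ltW m0) mp mq Ew.
(* With (k + 1) d e > 1, the bound of [prob_avoid_exp] for k + 1 blocks forces the avoidance
   probability below e. *)
pose k := Num.truncn ((d * e)^-1).
exists (k.+1 * size w)%N => n kn.
have := prob_avoid_exp E_catr E_catl k.+1 p01' (ltW d0) dE.
have := prob_avoid_anti E_catr p01' kn.
set g := prob _ _ _; set g' := prob _ _ _ => gg' bound.
have kd : 1 < k.+1%:R * d * e.
  have : (d * e)^-1 < k.+1%:R by apply: truncnS_gt.
  by rewrite -mulrA -ltr_pdivrMr ?div1r // mulr_gt0.
rewrite /survive; apply: le_lt_trans gg' _.
have g'0 : 0 <= g' by rewrite prob_ge0.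
rewrite ltNge; apply/negP => eg; rewrite -/E in bound.
have : e * (k.+1%:R * d) <= g' * (k.+1%:R * d).
  by apply: ler_wpM2r => //; rewrite mulr_ge0 // ltW.
move: bound kd; rewrite -/d; nra.
Qed.

(** Passage to the limit: the error term vanishes because survival probabilities tend to 0. *)
Lemma survive_lim p a b K : 0 < p < 1 -> 0 <= K -> forall n0,
  (forall n, (n0 <= n)%N -> a <= b + K * survive p n s0) -> a <= b.
Proof.
move=> p01 K0 n0 ab; rewrite leNgt; apply/negP => ba.
have e0 : 0 < (a - b) / (K + 1) by rewrite divr_gt0 //; lra.
have [N small] := survive_small p01 e0.
have := ab (maxn n0 N) (leq_maxl _ _); have := small _ (leq_maxr n0 N).
set g := survive _ _ _; rewrite ltr_pdivlMr; last by lra.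
have : 0 <= g by apply: prob_ge0; lra.
nra.
Qed.

Section Potential.
Variables (p : R) (p01 : 0 < p < 1) (h : Q -> R).
Hypothesis h_acc : forall s, acc s -> h s = 0.

Let p01' : 0 <= p <= 1. Proof. by case/andP: p01 => /ltW -> /ltW ->. Qed.

Let K := \sum_s `|h s|.

Let K_ge0 : 0 <= K. Proof. exact: sumr_ge0. Qed.

Let h_leK s : `|h s| <= K.
Proof. by rewrite /K (bigD1 s) //= lerDl sumr_ge0. Qed.

Lemma expect_live_le n s a : (forall t, h t <= a) ->
  expect p n (fun w => h (foldl step s w)) <= a * survive p n s.
Proof.
move=> ha; rewrite /survive /prob -expectZ; apply: le_expect => // w _.
by case: (boolP (acc _)) => [/h_acc ->|_] /=; rewrite ?mulr0 ?mulr1.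
Qed.

Lemma expect_live_norm n s : `|expect p n (fun w => h (foldl step s w))| <= K * survive p n s0.
Proof.
apply: le_trans (_ : K * survive p n s <= _); last by rewrite ler_wpM2l ?survive_max.
rewrite ler_norml; apply/andP; split; last first.
  by apply: expect_live_le => t; apply: le_trans (h_leK t); apply: ler_norm.
rewrite /survive /prob -mulNr -expectZ; apply: le_expect => // w _.
case: (boolP (acc _)) => [/h_acc ->|_] /=; rewrite ?mulr0 ?mulr1 //.
by rewrite lerNl; apply: le_trans (h_leK (foldl step s w)); rewrite -normrN ler_norm.
Qed.

(** Uniqueness for the hitting-time equations: after n steps only surviving paths contribute, and
    their weight tends to 0. *)
Lemma harmonic_eq0 : (forall s, h s = p * h (step s true) + (1 - p) * h (step s false)) ->
  forall s, h s = 0.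
Proof.
move=> hE s.
have hEn n t : h t = expect p n (fun w => h (foldl step t w)).
  by elim: n t => [|n IH] t //=; rewrite {1}hE {1}(IH (step t true)) {1}(IH (step t false)).
apply/eqP; rewrite -normr_le0; apply: (@survive_lim p _ 0 K p01 K_ge0 0) => n _.
by rewrite add0r {1}(hEn n s); apply: expect_live_norm.
Qed.

(* [h s] is the expected number of letters read from [s] before reaching [acc]. *)
Hypothesis h_eq : forall s,
  h s = (~~ acc s)%:R + p * h (step s true) + (1 - p) * h (step s false).

Lemma potential_iter n s :
  h s = \sum_(i < n) survive p i s + expect p n (fun w => h (foldl step s w)).
Proof.
elim: n s => [|n IH] s; first by rewrite big_ord0 add0r.
have -> : \sum_(i < n.+1) survive p i s = (~~ acc s)%:R +
    (p * (\sum_(i < n) survive p i (step s true)) +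
     (1 - p) * \sum_(i < n) survive p i (step s false)).
  by rewrite big_ord_recl /= !mulr_sumr -big_split.
by rewrite {1}h_eq {1}(IH (step s true)) {1}(IH (step s false)) /=; ring.
Qed.

(** With T = h s0, iteration gives T as the sum of all survival probabilities. These decrease,
    whence n P(survive) <= T. Since [s0] is the slowest start, at most T more letters are expected
    after time n, whence T <= n + T P(survive). *)
Lemma hitting_bounds n :
  [/\ \sum_(i < n) survive p i s0 <= h s0, n%:R * survive p n s0 <= h s0 &
    h s0 * (1 - survive p n s0) <= n%:R].
Proof.
pose G m := \sum_(i < m) survive p i s0.
have lower m : G m <= h s0 + K * survive p m s0.
  rewrite {1}(potential_iter m s0) -/(G m) -addrA lerDl.
  by have := expect_live_norm m s0; rewrite ler_norml => /andP[]; lra.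
have h_max s : h s <= h s0.
  apply: (@survive_lim p _ _ (K + K) p01 _ 0) => [|m _]; first by rewrite addr_ge0.
  rewrite {1}(potential_iter m s).
  have := expect_live_norm m s; rewrite ler_norml => /andP[_].
  have : \sum_(i < m) survive p i s <= G m.
    by apply: ler_sum => i _; apply: survive_max.
  have := lower m; lra.
have G_le m : G m <= h s0.
  apply: (@survive_lim p _ _ K p01 K_ge0 m) => m' /subnKC mm'.
  apply: le_trans (lower m'); rewrite -mm' /G big_split_ord /= lerDl sumr_ge0 // => i _.
  by rewrite prob_ge0.
split; first exact: G_le.
  apply: le_trans (G_le n); rewrite /G mulr_natl -[X in _ *+ X]card_ord -sumr_const.
  apply: ler_sum => i _; rewrite /survive.
  by apply: (prob_avoid_anti E_catr) => //; apply: ltnW.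
have := @expect_live_le n s0 (h s0) h_max.
have Gn : G n <= n%:R.
  rewrite -[X in _ <= X%:R]card_ord -sumr_const.
  by apply: ler_sum => i _; apply: prob_le1.
have := potential_iter n s0; rewrite -/(G n); lra.
Qed.

End Potential.

(* Cramer's rule for the linear system defining [h], whose matrix has
   polynomial entries in [p]. *)
Lemma rational_potential : exists A D : {poly R}, forall p, 0 < p < 1 ->
  D.[p] != 0 /\ exists h : Q -> R, [/\ (forall s, acc s -> h s = 0),
   (forall s, h s = (~~ acc s)%:R + p * h (step s true) + (1 - p) * h (step s false)) &
   h s0 = A.[p] / D.[p]].
Proof.
pose N := #|Q|.
(* Zero rows at accepting states make the system impose the value 0 there. *)
pose T : 'M[{poly R}]_N := \matrix_(i, j) (if acc (enum_val i) then 0 else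
   'X * (enum_rank (step (enum_val i) true) == j)%:R +
   (1 - 'X) * (enum_rank (step (enum_val i) false) == j)%:R).
pose B := 1%:M - T; pose D := \det B.
pose Y : 'cV[{poly R}]_N := \adj B *m \col_i (~~ acc (enum_val i))%:R.
exists (Y (enum_rank s0) 0), D => p p01.
have BE (y : 'cV[R]_N) i : (map_mx (horner_eval p) B *m y) i 0 = y i 0 -
    (if acc (enum_val i) then 0 else p * y (enum_rank (step (enum_val i) true)) 0
     + (1 - p) * y (enum_rank (step (enum_val i) false)) 0).
  rewrite mxE (eq_bigr (fun j => (i == j)%:R * y j 0 - (T i j).[p] * y j 0)) => [|j _]; last first.
    by rewrite !mxE /horner_eval hornerD hornerN hornerMn hornerC mulrBl.
  rewrite sumrB; congr (_ - _).
    rewrite (bigD1 i) //= eqxx mul1r big1 ?addr0 // => j ji.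
    by rewrite eq_sym (negPf ji) mul0r.
  have sum1 k : \sum_(j < N) (k == j)%:R * y j 0 = y k 0.
    rewrite (bigD1 k) //= eqxx mul1r big1 ?addr0 // => j jk.
    by rewrite eq_sym (negPf jk) mul0r.
  case: ifP => ai.
    by rewrite big1 // => j _; rewrite mxE ai horner0 mul0r.
  rewrite (eq_bigr (fun j => p * ((enum_rank (step (enum_val i) true) == j)%:R * y j 0) +
    (1 - p) * ((enum_rank (step (enum_val i) false) == j)%:R * y j 0))) => [|j _]; last first.
    rewrite mxE ai hornerD !hornerM hornerD hornerN hornerX !hornerMn !hornerC; ring.
  by rewrite big_split /= -!mulr_sumr !sum1.
(* A kernel vector of the specialised matrix would be harmonic and vanish on [acc], hence be
   zero. *)
have D0 : D.[p] != 0.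
  have -> : D.[p] = \det (map_mx (horner_eval p) B) by rewrite det_map_mx.
  rewrite -det_tr; apply/negP => /det0P[v v0 vB]; case/negP: v0; apply/eqP.
  pose z s := v 0 (enum_rank s).
  have vE i : v 0 i = if acc (enum_val i) then 0 else p * z (step (enum_val i) true)
      + (1 - p) * z (step (enum_val i) false).
    have := BE v^T i; rewrite -[map_mx _ _]trmxK -trmx_mul vB trmx0 !mxE => /eqP.
    by rewrite eq_sym subr_eq0 => /eqP.
  have z_acc s : acc s -> z s = 0 by rewrite /z vE enum_rankK => ->.
  have z0 : forall s, z s = 0.
    apply: (harmonic_eq0 p01 z_acc) => s; rewrite {1}/z vE enum_rankK.
    case: ifP => // acs; rewrite !z_acc ?mulr0 ?addr0 //; exact: acc_step.
  by apply/rowP => i; rewrite mxE -[i]enum_valK; apply: z0.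
split=> //; pose y := map_mx (horner_eval p) Y.
have yE i : y i 0 = D.[p] * (~~ acc (enum_val i))%:R +
    (if acc (enum_val i) then 0 else p * y (enum_rank (step (enum_val i) true)) 0
     + (1 - p) * y (enum_rank (step (enum_val i) false)) 0).
  apply/eqP; rewrite -subr_eq -BE /y -map_mxM /Y mulmxA mul_mx_adj -/D.
  by rewrite mul_scalar_mx !mxE /= /horner_eval hornerM hornerMn hornerC.
pose h s := y (enum_rank s) 0 / D.[p].
have h_acc s : acc s -> h s = 0 by move=> acs; rewrite /h yE enum_rankK acs mulr0 addr0 mul0r.
exists h; split=> // [s|]; last by rewrite /h mxE.
case: (boolP (acc s)) => acs.
  by rewrite !h_acc ?mulr0 ?addr0 //; apply: acc_step.
by rewrite /h yE enum_rankK (negPf acs) /=; field.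
Qed.

End HittingTime.

(** * Orders of vanishing at zero *)

Section PolynomialAtZero.
Variable R : realType.

(** Write A = q X^m with q(0) nonzero; by continuity |q| stays within half of |q(0)| of its value at
    0. *)
Lemma poly_near0 (A : {poly R}) : A != 0 -> exists (m : nat) (c C : R),
  [/\ 0 < c, 0 < C & \forall x \near (0 : R), 0 < x ->
    c * x ^+ m <= `|A.[x]| /\ `|A.[x]| <= C * x ^+ m].
Proof.
move=> A0; have [m [q]] := multiplicity_XsubC A 0.
rewrite A0 /= subr0 /root => q0 AE.
pose c := `|q.[0]|; have c0 : 0 < c by rewrite normr_gt0.
exists m, (c / 2), (c + c / 2); split; [by rewrite divr_gt0|by rewrite addr_gt0 ?divr_gt0|].
have : \forall x \near (0 : R), `|q.[0] - q.[x]| < c / 2.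
  have := @continuous_horner R q 0 => /cvgrPdist_lt; apply; exact: divr_gt0.
apply: filterS => x qx x0.
have xm : 0 <= x ^+ m by rewrite exprn_ge0 // ltW.
rewrite AE hornerM hornerXn normrM (ger0_norm xm).
split; apply: ler_wpM2r => //.
  have := ler_dist_dist q.[0] q.[x]; rewrite -/c.
  move: qx; case: (lerP 0 (c - `|q.[x]|)) => h qx; rewrite ?(ger0_norm h) ?(ltr0_norm h); lra.
have := ler_dist_dist q.[0] q.[x]; rewrite -/c.
move: qx; case: (lerP 0 (c - `|q.[x]|)) => h qx; rewrite ?(ger0_norm h) ?(ltr0_norm h); lra.
Qed.

(* The orders of vanishing of A and D are integers, so no power of x lies
   strictly between x ^ k and x ^ (k + 1). *)
Lemma poly_ratio_dichotomy (A D : {poly R}) k : A != 0 -> D != 0 ->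
  exists C : R, (\forall x \near (0 : R), 0 < x -> `|A.[x]| * x ^+ k <= C * `|D.[x]|) \/
    (\forall x \near (0 : R), 0 < x -> `|D.[x]| <= C * (`|A.[x]| * x ^+ k.+1)).
Proof.
move=> /poly_near0[a [cA [CA [cA0 CA0 nA]]]] /poly_near0[d [cD [CD [cD0 CD0 nD]]]].
have x1 : \forall x \near (0 : R), x <= 1.
  by near do apply: ltW; exact: lt_nbhsl.
have [le_d|lt_d] := leqP d (a + k).
  exists (CA / cD); left; near=> x => x0.
  have /(_ x0)[_ Ax] : 0 < x -> cA * x ^+ a <= `|A.[x]| /\ `|A.[x]| <= CA * x ^+ a by near: x.
  have /(_ x0)[Dx _] : 0 < x -> cD * x ^+ d <= `|D.[x]| /\ `|D.[x]| <= CD * x ^+ d by near: x.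
  have xk : 0 <= x ^+ k by rewrite exprn_ge0 // ltW.
  have : x ^+ (a + k) <= x ^+ d.
    by apply: ler_wiXn2l => //; [exact: ltW|near: x].
  rewrite exprD => xad; apply: (@le_trans _ _ (CA * x ^+ a * x ^+ k)).
    exact: ler_wpM2r.
  apply: (@le_trans _ _ (CA * x ^+ d)); first by rewrite -mulrA ler_wpM2l // ltW.
  by rewrite -mulrA (ler_wpM2l (ltW CA0)) // mulrC ler_pdivlMr // mulrC.
exists (CD / cA); right; near=> x => x0.
have /(_ x0)[Ax _] : 0 < x -> cA * x ^+ a <= `|A.[x]| /\ `|A.[x]| <= CA * x ^+ a by near: x.
have /(_ x0)[_ Dx] : 0 < x -> cD * x ^+ d <= `|D.[x]| /\ `|D.[x]| <= CD * x ^+ d by near: x.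
have xk : 0 <= x ^+ k.+1 by rewrite exprn_ge0 // ltW.
have : x ^+ d <= x ^+ (a + k.+1).
  by apply: ler_wiXn2l; [exact: ltW|near: x|rewrite addnS].
rewrite exprD => xad; apply: le_trans Dx _.
apply: (@le_trans _ _ (CD * (x ^+ a * x ^+ k.+1))); first by rewrite ler_wpM2l // ltW.
rewrite -mulrA (ler_wpM2l (ltW CD0)) // mulrA ler_wpM2r // mulrC ler_pdivlMr // mulrC //.
Unshelve. all: by end_near.
Qed.

End PolynomialAtZero.

Section IdealDichotomy.
Variables (R : realType) (r : nat) (x : tp_class r).

Let step (y : tp_class r) (b : bool) : tp_class r := (y * class r [:: b])%g.
Let acc (y : tp_class r) : bool := `[< leJ y x >].

Let foldl_step y w : foldl step y w = (y * class r w)%g.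
Proof.
elim: w y => [|b w IH] y /=; first by rewrite (mulg1 y).
by rewrite IH /step -mulgA -classM.
Qed.

Let acc_mul a y b : acc y -> acc (a * y * b)%g.
Proof. by move=> /asboolP yx; apply/asboolP; apply: leJ_trans yx; exists a, b. Qed.

Let acc_J w : acc (foldl step 1%g w) = J_below x w.
Proof. by rewrite foldl_step mul1g. Qed.

(** The automaton is right multiplication on the monoid, with the ideal below [x] as target. Its
    hitting time T is A/D, so either T p^k or 1 / (T p^(k+1)) stays bounded near 0, and
    [hitting_bounds] turns each into a probability bound. *)
Lemma J_below_dichotomy k : exists C : R,
  (\forall p \near (0 : R), 0 < p -> forall n,
     n%:R * p ^+ k * prob p n (predC (J_below x)) <= C) \/
  (\forall p \near (0 : R), 0 < p -> forall n,
     prob p n (J_below x) <= C * (n%:R * p ^+ k.+1)).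
Proof.
have acc_step s b : acc s -> acc (step s b).
  by move=> /(acc_mul 1 (class r [:: b])); rewrite mul1g.
have acc_start s w : acc (foldl step 1%g w) -> acc (foldl step s w).
  by rewrite !foldl_step mul1g => /(acc_mul s 1); rewrite mulg1.
have acc_reach : exists w, acc (foldl step 1%g w).
  exists (class_rep x); rewrite acc_J /J_below class_repK; apply/asboolP.
  by exists 1%g, 1%g; rewrite mul1g mulg1.
have surviveE p n : survive step acc p n 1%g = prob p n (predC (J_below x)).
  by apply: eq_prob => w _; rewrite acc_J.
(* If the empty word is already in the ideal then T = 0 and A is the zero polynomial, so this case
   stands apart. *)
have [acc1|acc1] := boolP (acc 1%g).
  exists 0; left; near=> p => p0 n.
  rewrite (eq_prob _ (E' := fun=> false)) => [|w _] /=.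
    by rewrite /prob expect_cst mulr0.
  by rewrite -acc_J acc_run.
have [A [D AD]] := rational_potential R acc_step acc_start acc_reach.
have lt1 : \forall p \near (0 : R), p < 1 by exact: lt_nbhsl.
(* Evaluation at 1/2 suffices to see that A and D are nonzero polynomials. *)
have half01 : 0 < (2^-1 : R) < 1 by rewrite invr_gt0 ltr0n invf_lt1 ?ltr1n.
have bounds p n : 0 < p < 1 -> [/\ D.[p] != 0, 1 <= A.[p] / D.[p],
    n%:R * prob p n (predC (J_below x)) <= A.[p] / D.[p] &
    A.[p] / D.[p] * prob p n (J_below x) <= n%:R].
  move=> p01; have [D0 [h [h_acc h_eq <-]]] := AD p p01.
  have b m := hitting_bounds acc_step acc_start acc_reach p01 h_acc h_eq m.
  have [_ b1 b2] := b n; rewrite surviveE in b1 b2; split=> //; last first.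
    by move: b2; rewrite prob_predC subKr.
  have [+ _ _] := b 1%N; rewrite big_ord1; apply: le_trans.
  by rewrite /survive /prob /= acc1.
have A0 : A != 0.
  apply/eqP => A0; have [_ + _ _] := bounds _ 0 half01.
  by rewrite A0 horner0 mul0r ler10.
have D0 : D != 0.
  apply/eqP => D0; have [+ _ _ _] := bounds _ 0 half01.
  by rewrite D0 horner0 eqxx.
have [C AD_dich] := poly_ratio_dichotomy k A0 D0; exists C.
case: AD_dich => AD_near; [left|right]; near=> p => p0 n;
  (have p01 : 0 < p < 1 by rewrite p0 /=; near: p);
  have [Dp T1 b1 b2] := bounds p n p01;
  set T := A.[p] / D.[p] in T1 b1 b2;
  have normA : `|A.[p]| = T * `|D.[p]|
    by rewrite -(ger0_norm (le_trans ler01 T1)) -normrM /T divfK.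
- have /(_ p0) : 0 < p -> `|A.[p]| * p ^+ k <= C * `|D.[p]| by near: p.
  rewrite normA mulrAC ler_pM2r ?normr_gt0 // => TC; apply: le_trans TC.
  by rewrite mulrAC ler_wpM2r // exprn_ge0 // ltW.
- have /(_ p0) : 0 < p -> `|D.[p]| <= C * (`|A.[p]| * p ^+ k.+1) by near: p.
  rewrite normA mulrAC -{1}[`|D.[p]|]mul1r mulrA ler_pM2r ?normr_gt0 // => TC.
  have f0 : 0 <= prob p n (J_below x) by rewrite prob_ge0; lra.
  have Cp0 : 0 < C * p ^+ k.+1.
    have : 0 < C * p ^+ k.+1 * T by nra.
    by rewrite pmulr_lgt0 // (lt_le_trans ltr01).
  nra.
Unshelve. all: by end_near.
Qed.

End IdealDichotomy.

(** * The zero-one regimes *)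

Section Asymptotics.
Variable R : realType.
Implicit Types u p : nat -> R.

Lemma cvg0_nonneg u : (\forall n \near \oo, 0 <= u n) ->
  u n @[n --> \oo] --> (0 : R) <-> forall e : R, 0 < e -> \forall n \near \oo, u n < e.
Proof.
move=> u0; rewrite cvgr0Pnorm_lt; split=> H e /H ue; near=> n.
  by apply: le_lt_trans (ler_norm _) _; near: n.
by rewrite ger0_norm; near: n.
Unshelve. all: by end_near.
Qed.

Lemma cvgy_near u A : u n @[n --> \oo] --> +oo -> \forall n \near \oo, A <= u n.
Proof. by move=> /cvgryPge. Qed.

Lemma cvg0_expr u k : (0 < k)%N -> (\forall n \near \oo, 0 <= u n) ->
  u n @[n --> \oo] --> (0 : R) <-> u n ^+ k @[n --> \oo] --> (0 : R).
Proof.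
move=> k0 u0; have uk0 : \forall n \near \oo, 0 <= u n ^+ k.
  by apply: filterS u0 => n; apply: exprn_ge0.
rewrite (cvg0_nonneg u0) (cvg0_nonneg uk0); split=> H e e0.
  have e1 : 0 < Num.min e 1 by rewrite lt_min e0 ltr01.
  near=> n; have un : 0 <= u n by near: n.
  have : u n < Num.min e 1 by near: n; apply: H.
  rewrite lt_min => /andP[une un1]; apply: le_lt_trans une.
  by rewrite -[leRHS]expr1; apply: ler_wiXn2l => //; apply: ltW.
have := H _ (exprn_gt0 k e0); apply: filterS2 u0 => n un.
by rewrite ltr_pXn2r // nnegrE // ltW.
Unshelve. all: by end_near.
Qed.

Lemma cvgy_expr u k : (0 < k)%N -> (\forall n \near \oo, 0 <= u n) ->
  u n @[n --> \oo] --> +oo <-> u n ^+ k @[n --> \oo] --> +oo.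
Proof.
move=> k0 u0; rewrite !cvgryPge; split=> H A.
  near=> n; have : Num.max A 1 <= u n by near: n; apply: H.
  rewrite ge_max => /andP[Au u1]; apply: le_trans Au _.
  by rewrite -[leLHS]expr1; apply: ler_weXn2l.
near=> n; have un : 0 <= u n by near: n.
have : Num.max A 0 ^+ k <= u n ^+ k by near: n; apply: H.
rewrite ler_pXn2r ?nnegrE ?le_max ?lexx ?orbT //.
by rewrite ge_max => /andP[].
Unshelve. all: by end_near.
Qed.

Lemma powR_natV_expr n k : (0 < k)%N -> (n%:R `^ (k%:R^-1 : R)) ^+ k = n%:R.
Proof.
move=> k0; rewrite -powR_mulrn ?powR_ge0 // -powRrM mulVf ?powRr1 //.
by rewrite pnatr_eq0 -lt0n.
Qed.

Section UnitInterval.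
Variables (p : nat -> R).
Hypothesis p_ge0 : \forall n \near \oo, 0 <= p n.

Let a_ge0 k : \forall n \near \oo, 0 <= p n * n%:R `^ (k%:R^-1 : R).
Proof. by apply: filterS p_ge0 => n pn; rewrite mulr_ge0 ?powR_ge0. Qed.

Let aE k n : (0 < k)%N -> (p n * n%:R `^ (k%:R^-1 : R)) ^+ k = n%:R * p n ^+ k.
Proof. by move=> k0; rewrite exprMn powR_natV_expr // mulrC. Qed.

(** The k-th power of p n^(1/k) is n p^k, which removes real exponents from the growth
    conditions. *)
Lemma ll_powP k : (0 < k)%N ->
  ll_pow p (k%:R^-1) <-> n%:R * p n ^+ k @[n --> \oo] --> (0 : R).
Proof.
move=> k0; have E : (fun n => n%:R * p n ^+ k) = fun n => (p n * n%:R `^ (k%:R^-1 : R)) ^+ k.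
  by apply: funext => n; rewrite aE.
rewrite E -(cvg0_expr k0 (a_ge0 k)) /ll_pow.
by under eq_fun do rewrite powRN invrK.
Qed.

Lemma pow_llP k : (0 < k)%N ->
  pow_ll (k%:R^-1) p <-> n%:R * p n ^+ k @[n --> \oo] --> +oo.
Proof.
move=> k0; have E : (fun n => n%:R * p n ^+ k) = fun n => (p n * n%:R `^ (k%:R^-1 : R)) ^+ k.
  by apply: funext => n; rewrite aE.
by rewrite E -(cvgy_expr k0 (a_ge0 k)).
Qed.

Lemma pow_ll_all : (forall eps : R, 0 < eps -> pow_ll eps p) <->
  forall k, (0 < k)%N -> n%:R * p n ^+ k @[n --> \oo] --> +oo.
Proof.
split=> H k => [k0|e0].
  by apply/(pow_llP k0)/H; rewrite invr_gt0 ltr0n.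
(* Here [k] is the real exponent epsilon, and m is an integer with 1/m <= epsilon. *)
pose m := (Num.truncn k^-1).+1; have m0 : (0 < m)%N by [].
have mk : (m%:R : R)^-1 <= k.
  have m0' : (0 : R) < m%:R by rewrite ltr0n.
  by rewrite invf_ple ?posrE // ltW // truncnS_gt.
have := (pow_llP m0).2 (H m m0); rewrite /pow_ll !cvgryPge => pm A.
near=> n; have : A <= p n * n%:R `^ (m%:R^-1 : R) by near: n; apply: pm.
move=> /le_trans; apply; have pn : 0 <= p n by near: n.
have n0 : (0 < n)%N by near: n; exact: nbhs_infty_gt.
by apply: ler_wpM2l => //; apply: ler_powR => //; rewrite ler1n.
Unshelve. all: by end_near.
Qed.

End UnitInterval.

Lemma cvg_div_y u C : u n @[n --> \oo] --> +oo -> C / u n @[n --> \oo] --> (0 : R).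
Proof.
rewrite cvgryPge => uy; rewrite cvgr0Pnorm_lt => e e0; near=> n.
have : Num.max 1 ((`|C| + 1) / e) <= u n by near: n; apply: uy.
rewrite ge_max => /andP[u1 uC]; have u0 : 0 < u n by apply: lt_le_trans u1.
rewrite normrM normrV ?unitfE ?gt_eqF // (gtr0_norm u0) ltr_pdivrMr //.
by move: uC; rewrite ler_pdivrMr // mulrC; apply: lt_le_trans; rewrite ltrDl.
Unshelve. all: by end_near.
Qed.

End Asymptotics.

Section Regimes.
Variables (R : realType) (p : nat -> R).
Hypothesis p01 : forall n, (0 < n)%N -> 0 <= p n <= 1.

Let p01_near : \forall n \near \oo, 0 <= p n <= 1.
Proof. by exists 1%N => // n /= n1; apply: p01. Qed.

Lemma zero_one_middle : (forall k, (0 < k)%N -> n%:R * p n ^+ k @[n --> \oo] --> +oo) ->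
  (forall k, (0 < k)%N -> n%:R * (1 - p n) ^+ k @[n --> \oo] --> +oo) -> zero_one_law p.
Proof.
move=> pk qk S; pose r := (qdepth S).+2.
apply: (modw_zero_one (r := r) (low := xpredT)) => // x; rewrite /J_error /=.
(* The additional letter makes L positive even if the representative is empty. *)
pose w := true :: class_rep x; pose L := size w.
have Ew : J_below x w.
  apply: (@J_below_catl _ _ [:: true]); rewrite /J_below class_repK; apply/asboolP.
  by exists 1%g, 1%g; rewrite mul1g mulg1.
pose m n := Num.min (p n) (1 - p n).
have nm : n%:R * m n ^+ L @[n --> \oo] --> +oo.
  rewrite cvgryPge => A; near=> n; rewrite /m minEle; case: ifP => _; near: n.
    exact: (cvgy_near A (pk L isT)).
  exact: (cvgy_near A (qk L isT)).
apply: (squeeze_cvgr _ (cvg_cst _) (cvg_div_y (2 * L%:R) nm)); near=> n.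
have pn : 0 <= p n <= 1 by near: n.
have [mp mq] : m n <= p n /\ m n <= 1 - p n by rewrite !ge_min !lexx orbT.
have m0 : 0 <= m n by rewrite le_min; lra.
have nm0 : 0 < n%:R * m n ^+ L.
  by apply: (@lt_le_trans _ _ 1) => //; near: n; exact: (cvgy_near 1 nm).
rewrite prob_ge0 //= ler_pdivlMr //.
have dE := prob_word_ge m0 mp mq Ew; rewrite -/L in dE.
set d := m n ^+ L in nm0 dE *; have d0 : 0 <= d by rewrite exprn_ge0.
have d1 : d <= 1 by apply: le_trans dE _; apply: prob_le1.
(* The half word contains j disjoint blocks of length L, each equal to w with probability at least
   d; as j is about n / (2 L), avoidance has probability at most 2 L / (n d). *)
pose j := (n./2 %/ L)%N.
have := prob_avoid_exp (@J_below_catr _ x) (@J_below_catl _ x) j pn d0 dE.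
have : prob (p n) n./2 (predC (J_below x)) <= prob (p n) (j * L) (predC (J_below x)).
  by apply: (prob_avoid_anti (@J_below_catr _ x)) => //; apply: leq_trunc_div.
have g0 : 0 <= prob (p n) n./2 (predC (J_below x)) by exact: prob_ge0.
set g := prob _ n./2 _ in g0 *; set g' := prob _ _ _ => gg' bound.
have nj : n%:R <= 2 * L%:R * (j%:R + 1) :> R.
  rewrite natr1 -!natrM ler_nat.
  have := ltn_ceil n./2 (isT : (0 < L)%N); rewrite -/j -mulnA [(L * _)%N]mulnC.
  by move: (j.+1 * L)%N => m'; lia.
have Ld : n%:R * d <= 2 * L%:R * (1 + j%:R * d).
  apply: (@le_trans _ _ (2 * L%:R * (j%:R + 1) * d)); first exact: ler_wpM2r.
  by rewrite -mulrA ler_wpM2l ?mulr_ge0 // mulrDl mul1r addrC lerD2r.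
have jd0 : 0 <= 1 + j%:R * d by rewrite addr_ge0 ?mulr_ge0.
apply: (@le_trans _ _ (g * (2 * L%:R * (1 + j%:R * d)))); first exact: ler_wpM2l.
rewrite mulrCA ler_piMr ?mulr_ge0 //; apply: le_trans bound; exact: ler_wpM2r.
Unshelve. all: by end_near.
Qed.

Lemma zero_one_power k : (0 < k)%N -> n%:R * p n ^+ k @[n --> \oo] --> +oo ->
  n%:R * p n ^+ k.+1 @[n --> \oo] --> (0 : R) -> zero_one_law p.
Proof.
move=> k0 npk npk1 S; pose r := (qdepth S).+2.
have p0 : \forall n \near \oo, 0 < p n.
  near=> n; have pn : 0 <= p n <= 1 by near: n.
  rewrite lt_neqAle (andP pn).1 andbT eq_sym; apply/eqP => p0.
  have : 1 <= n%:R * p n ^+ k by near: n; exact: (cvgy_near 1 npk).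
  by rewrite p0 expr0n gtn_eqF // mulr0 ler10.
(* The dichotomy holds only for small positive p, so both p > 0 and p tending to 0 are secured
   first. *)
have pto0 : p n @[n --> \oo] --> (0 : R).
  apply/(@cvg0_expr _ _ k.+1) => //; first by apply: filterS p0 => n /ltW.
  apply: (squeeze_cvgr _ (cvg_cst _) npk1); near=> n.
  have pn : 0 < p n by near: n.
  have n0 : (0 < n)%N by near: n; exact: nbhs_infty_gt.
  have pk0 : 0 <= p n ^+ k.+1 by rewrite exprn_ge0 // ltW.
  by rewrite pk0 /= ler_peMl // ler1n.
pose slow C (x : tp_class r) := \forall t \near (0 : R), 0 < t -> forall n,
  n%:R * t ^+ k * prob t n (predC (J_below x)) <= C.
apply: (modw_zero_one (r := r) (low := fun x => `[< exists C, slow C x >])) => // x.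
rewrite /J_error; case: asboolP => [[C Cx]|no_slow].
  (* The factor 3 pays for the halved length: n <= 3 (n/2) with n/2 rounded down, once n >= 2. *)
  apply: (squeeze_cvgr _ (cvg_cst _) (cvg_div_y (3 * C) npk)); near=> n.
  have pn : 0 <= p n <= 1 by near: n.
  have pn0 : 0 < p n by near: n.
  have n2 : (1 < n)%N by near: n; exact: nbhs_infty_gt.
  have n0 : 0 < (n%:R : R) by rewrite ltr0n ltnW.
  rewrite prob_ge0 //= ler_pdivlMr; last by rewrite mulr_gt0 // exprn_gt0.
  have : 0 < p n -> forall n', n'%:R * p n ^+ k * prob (p n) n' (predC (J_below x)) <= C.
    by near: n; exact: pto0 Cx.
  move=> /(_ pn0 n./2).
  have g0 : 0 <= prob (p n) n./2 (predC (J_below x)) by exact: prob_ge0.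
  set g := prob _ _ _ in g0 * => gC.
  have n3 : n%:R <= 3 * n./2%:R :> R by rewrite -natrM ler_nat; lia.
  have pkn : 0 <= p n ^+ k * g by rewrite mulr_ge0 // exprn_ge0 // ltW.
  nra.
have [C [Cx|Cx]] := J_below_dichotomy R x k; first by case: no_slow; exists C.
have C0 : C * (n%:R * p n ^+ k.+1) @[n --> \oo] --> (0 : R).
  by rewrite -(mulr0 C); apply: cvgM => //; exact: cvg_cst.
apply: (squeeze_cvgr _ (cvg_cst _) C0); near=> n.
have pn : 0 <= p n <= 1 by near: n.
have pn0 : 0 < p n by near: n.
rewrite prob_ge0 //=.
have : 0 < p n -> forall n', prob (p n) n' (J_below x) <= C * (n'%:R * p n ^+ k.+1).
  by near: n; exact: pto0 Cx.
by apply.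
Unshelve. all: by end_near.
Qed.

Lemma prob_has_le (t : R) n : 0 <= t <= 1 -> prob t n (has id) <= n%:R * t.
Proof.
move=> t01; elim: n => [|n IH]; first by rewrite /prob /= mul0r.
rewrite /prob /= expect_cst -natr1 -/(prob t n (has id)).
have := prob_ge0 t01 n (has id); move: IH; set g := prob _ _ _; nra.
Qed.

Lemma zero_one_empty : n%:R * p n @[n --> \oo] --> (0 : R) -> zero_one_law p.
Proof.
move=> np S; pose r := (qdepth S).+2.
have no_one n (w : seq bool) : size w = n -> ~~ has id w -> w = nseq n false.
  by move=> <-; elim: w => //= -[] w IH //= /IH {1}->.
(* Except with probability at most n p the word has no [true], so the ideals entered are those
   reached by words of [false] alone. *)
pose low (x : tp_class r) := `[< exists m, J_below x (nseq m false) >].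
apply: (modw_zero_one (r := r) (low := low)) => // x.
rewrite /J_error /low; case: asboolP => [[m mx]|none].
  apply: (squeeze_cvgr _ (cvg_cst _) np); near=> n.
  have pn : 0 <= p n <= 1 by near: n.
  have mn : (m <= n./2)%N.
    by have : (m.*2 <= n)%N; [near: n; exact: nbhs_infty_ge|lia].
  rewrite prob_ge0 //=; apply: le_trans (_ : n./2%:R * p n <= _); last first.
    by apply: ler_wpM2r; [case/andP: pn|rewrite ler_nat; lia].
  apply: le_trans (prob_has_le _ pn); apply: le_prob => // w sw.
  apply: contraR => /(no_one _ _ sw) ->; rewrite -(subnKC mn) nseqD.
  exact: J_below_catr.
apply: (squeeze_cvgr _ (cvg_cst _) np); near=> n.
have pn : 0 <= p n <= 1 by near: n.
rewrite prob_ge0 //=; apply: le_trans (prob_has_le _ pn); apply: le_prob => // w sw wx.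
by apply: contraT => /(no_one _ _ sw) ww; case: none; exists n; rewrite -ww.
Unshelve. all: by end_near.
Qed.

End Regimes.

(** * Run sentences *)

Fixpoint swap_U k (phi : formula k) : formula k :=
  match phi with
  | FEq i j => FEq i j
  | FU i => FNot (FU i)
  | FC i j l => FC i j l
  | FNot f => FNot (swap_U f)
  | FAnd f g => FAnd (swap_U f) (swap_U g)
  | FOr f g => FOr (swap_U f) (swap_U g)
  | FImp f g => FImp (swap_U f) (swap_U g)
  | FEx f => FEx (swap_U f)
  | FAll f => FAll (swap_U f)
  end.

Lemma sat_swap_U (T : finType) (C : T -> T -> T -> bool) (U : T -> bool) k (phi : formula k) e :
  sat C U (swap_U phi) e = sat C (fun x => ~~ U x) phi e.
Proof.
elim: phi e => {k} //=.
- by move=> k f IH e; rewrite IH.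
- by move=> k f IHf g IHg e; rewrite IHf IHg.
- by move=> k f IHf g IHg e; rewrite IHf IHg.
- by move=> k f IHf g IHg e; rewrite IHf IHg.
- by move=> k f IH e; apply: eq_existsb => x; rewrite IH.
- by move=> k f IH e; apply: eq_forallb => x; rewrite IH.
Qed.

Lemma modw_swap_U S w : modw (swap_U S) w = modw S (map negb w).
Proof.
rewrite /modw sat_swap_U; apply: (@sat_word _ _ _ _ _ (qdepth S).+2) => //.
rewrite word_tnth; congr (tp _ _).
by rewrite -[in RHS](word_tnth w) /word -map_comp.
Qed.

Lemma prob_swap (R : realType) (p : R) n E :
  prob (1 - p) n E = prob p n (fun w => E (map negb w)).
Proof.
elim: n E => [|n IH] E //; rewrite /prob /=.
have := IH (fun w => E (true :: w)); have := IH (fun w => E (false :: w)).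
by rewrite /prob => -> ->; rewrite subKr addrC.
Qed.

Lemma pr_models_swap_U (R : realType) (p : R) n S :
  pr_models n p (swap_U S) = pr_models n (1 - p) S.
Proof. by rewrite !pr_models_prob prob_swap; apply: eq_prob => w _; rewrite modw_swap_U. Qed.

Lemma zero_one_law_swap (R : realType) (p : nat -> R) :
  zero_one_law p -> zero_one_law (fun n => 1 - p n).
Proof.
move=> law S; have := law (swap_U S).
by under eq_fun do rewrite pr_models_swap_U.
Qed.

Section RunSentence.

(** Cyclic successor: nothing lies strictly between x and y on the way from x. *)
Definition FSucc k (x y : 'I_k) : formula k :=
  FAnd (FNot (FEq x y)) (FAll (FNot (FC (lift ord0 x) ord0 (lift ord0 y)))).

(** The run has j + 1 elements, starts at variable 0 and may wrap around the cycle. *)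
Fixpoint FRun (j k : nat) : formula k.+1 :=
  if j is j'.+1 then
    FAnd (FU ord0) (FEx (FAnd (FSucc (lift ord0 ord0) ord0) (FRun j' k.+1)))
  else FU ord0.

Definition run_sentence j : sentence := FEx (FRun j 0).

Lemma env_cons0 (T : Type) k (x : T) (e : 'I_k -> T) : env_cons x e ord0 = x.
Proof. by rewrite /env_cons unlift_none. Qed.

Lemma env_consS (T : Type) k (x : T) (e : 'I_k -> T) i : env_cons x e (lift ord0 i) = e i.
Proof. by rewrite /env_cons liftK. Qed.

Lemma sat_FSucc n (U : 'I_n -> bool) k (x y : 'I_k) (e : 'I_k -> 'I_n) :
  sat (@circ n) U (FSucc x y) e = (e x != e y) && [forall z, ~~ circ (e x) z (e y)].
Proof. by congr (_ && _); apply: eq_forallb => z; rewrite /= env_cons0 !env_consS. Qed.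

Lemma sat_FRunS n (U : 'I_n -> bool) j k (e : 'I_k.+1 -> 'I_n) :
  sat (@circ n) U (FRun j.+1 k) e = U (e ord0) && [exists y, [&& e ord0 != y,
    [forall z, ~~ circ (e ord0) z y] & sat (@circ n) U (FRun j k.+1) (env_cons y e)]].
Proof.
rewrite [LHS]/=; congr (_ && _); apply: eq_existsb => y.
rewrite -/(sat _ _ _ _) -[X in X && _]/(sat (@circ n) U (FSucc _ _) _).
by rewrite sat_FSucc env_consS env_cons0 andbA.
Qed.

Lemma FRun_intro n (U : 'I_n -> bool) j k (e : 'I_k.+1 -> 'I_n) :
  (forall i, (i <= j)%N -> exists y : 'I_n, y = (e ord0 + i)%N :> nat /\ U y) ->
  sat (@circ n) U (FRun j k) e.
Proof.
elim: j k e => [|j IH] k e run.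
  by have [y [/eqP]] := run 0 isT; rewrite addn0 => /eqP/val_inj->.
rewrite sat_FRunS; apply/andP; split.
  by have [y [/eqP]] := run 0 isT; rewrite addn0 => /eqP/val_inj->.
have [y [ey _]] := run 1%N isT; apply/existsP; exists y; apply/and3P; split.
- by rewrite -(inj_eq val_inj) /= ey; lia.
- by apply/forallP => z; rewrite /circ ey; lia.
- apply: IH => i ij; have [y' [ey' Uy']] := run i.+1 ij.
  by exists y'; rewrite env_cons0 ey' ey; split=> //; lia.
Qed.

(* A run cannot wrap around past a position 0 outside U. *)
Lemma FRun_elim n (U : 'I_n -> bool) j k (e : 'I_k.+1 -> 'I_n) :
  (forall y : 'I_n, y = 0 :> nat -> ~~ U y) -> sat (@circ n) U (FRun j k) e ->
  forall i, (i <= j)%N -> exists y : 'I_n, y = (e ord0 + i)%N :> nat /\ U y.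
Proof.
move=> U0; have Uhead j' k' (e' : 'I_k'.+1 -> 'I_n) :
    sat (@circ n) U (FRun j' k') e' -> U (e' ord0).
  by case: j' => [|j'] //; rewrite sat_FRunS => /andP[].
elim: j k e => [|j IH] k e run [|i] // ij; try by exists (e ord0); rewrite addn0 (Uhead _ _ _ run).
move: run; rewrite sat_FRunS => /andP[_ /existsP[y /and3P[ey /forallP noz run]]].
have := Uhead _ _ _ run; rewrite env_cons0 => Uy.
have y0 : y != 0 :> nat by apply/negP => /eqP/U0; rewrite Uy.
have yE : y = (e ord0).+1 :> nat.
  have lt_y := ltn_ord y; have lt_e := ltn_ord (e ord0).
  move: ey; rewrite -(inj_eq val_inj) /= => ey.
  have [en|en] := eqVneq (e ord0).+1 n.
    have n0 : (0 < n)%N by lia.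
    by have := noz (Ordinal n0); rewrite /circ /=; lia.
  have lt_e1 : ((e ord0).+1 < n)%N by lia.
  by have := noz (Ordinal lt_e1); rewrite /circ /=; lia.
have [y' [ey' Uy']] := IH _ _ run i ij; exists y'; split=> //.
by rewrite ey' env_cons0 yE; lia.
Qed.

Lemma modw_run_sentence j w : infix (nseq j.+1 true) w -> modw (run_sentence j) w.
Proof.
move=> /infixP[a [b ew]]; apply/existsP.
have sw : (size a + j < size w)%N by rewrite ew !size_cat size_nseq; lia.
have sa : (size a < size w)%N by lia.
exists (Ordinal sa); apply: FRun_intro => i ij; rewrite env_cons0 /=.
have si : (size a + i < size w)%N by lia.
exists (Ordinal si); split=> //; rewrite (tnth_nth false) [nth _ _ _]/= ew nth_cat.
by rewrite ifN -?leqNgt ?leq_addr // addKn nth_cat size_nseq ltnS ij nth_nseq ltnS ij.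
Qed.

Lemma modw_run_sentence_false j w :
  modw (run_sentence j) (false :: w) -> infix (nseq j.+1 true) w.
Proof.
move=> /existsP[x /FRun_elim run].
have {}run := run _; rewrite env_cons0 in run.
have {}run : forall i, (i <= j)%N -> nth false (false :: w) (x + i).
  move=> i ij; have [|y [<- Uy]] := run _ i ij; last by rewrite (tnth_nth false) in Uy.
  by move=> y y0; rewrite (tnth_nth false) y0.
have x0 : (0 < x)%N.
  by rewrite lt0n; apply/negP => /eqP x0; have := run 0 isT; rewrite x0.
have runw i : (i <= j)%N -> nth false w (x.-1 + i).
  by move=> /run; rewrite -[x in nth _ _ (x + _)](prednK x0).
(* The default value of [nth] is [false], so the run cannot pass the end of [w]. *)
have sz : (x.-1 + j < size w)%N.
  by rewrite ltnNge; apply/negP => sz; have := runw j (leqnn j); rewrite nth_default.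
apply/infixP; exists (take x.-1 w), (drop (x.-1 + j.+1) w).
rewrite -{1}(cat_take_drop x.-1 w); congr (_ ++ _).
rewrite -{1}(cat_take_drop j.+1 (drop x.-1 w)) drop_drop addnC; congr (_ ++ _).
have sz' : size (take j.+1 (drop x.-1 w)) = j.+1.
  by rewrite size_take size_drop; case: ifP; lia.
apply: (@eq_from_nth _ false); first by rewrite sz' size_nseq.
by rewrite sz' => i ij; rewrite nth_take // nth_drop nth_nseq ij runw.
Qed.

End RunSentence.

(** * Harris' inequality and the probability of runs *)

Section Harris.
Variables (R : realType) (p : R) (p01 : 0 <= p <= 1).
Implicit Types F G : seq bool -> R.

Definition decreasing_in_U F : Prop :=
  forall a b, F (a ++ true :: b) <= F (a ++ false :: b).

Lemma harris n F G : decreasing_in_U F -> decreasing_in_U G ->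
  expect p n F * expect p n G <= expect p n (fun w => F w * G w).
Proof.
elim: n F G => [|n IH] F G decF decG //=.
have dec b H : decreasing_in_U H -> decreasing_in_U (fun w => H (b :: w)).
  by move=> decH x y; apply: (decH (b :: x)).
have drop H : decreasing_in_U H ->
    expect p n (fun w => H (true :: w)) <= expect p n (fun w => H (false :: w)).
  by move=> decH; apply: le_expect => // w _; apply: (decH [::]).
have IHb b := IH (fun w => F (b :: w)) (fun w => G (b :: w)) (dec b F decF) (dec b G decG).
case/andP: p01 => p0 p1; have q0 : 0 <= 1 - p by lra.
have := ler_wpM2l p0 (IHb true); have := ler_wpM2l q0 (IHb false).
have dF := drop F decF; have dG := drop G decG; rewrite -subr_ge0 in dF; rewrite -subr_ge0 in dG.
(* Conditioning on the first letter leaves the covariance of the two conditional means, p (1 - p)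
   times the product of their drops; it is nonnegative. *)
have := mulr_ge0 (mulr_ge0 p0 q0) (mulr_ge0 dF dG).
nra.
Qed.

End Harris.

Section Runs.
Variable (R : realType).

Lemma prob_ones (p : R) k (E : pred (seq bool)) :
  0 <= p <= 1 -> E (nseq k true) -> p ^+ k <= prob p k E.
Proof.
move=> p01; elim: k E => [|k IH] E Ek; first by rewrite expr0 /prob /= Ek.
have := IH (fun w => E (true :: w)) Ek.
have := prob_ge0 p01 k (fun w => E (false :: w)); rewrite exprS /prob /=.
case/andP: p01 => p0 p1; nra.
Qed.

Lemma prob_prefix_ones (p : R) n k : 0 <= p <= 1 ->
  prob p n (prefix (nseq k true)) <= p ^+ k.
Proof.
move=> p01; elim: n k => [|n IH] [|k]; rewrite ?expr0 ?prob_le1 //.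
  by rewrite /prob /= exprn_ge0 //; case/andP: p01.
rewrite exprS /prob /= expect_cst mulr0 addr0.
by apply: ler_wpM2l; [case/andP: p01|apply: IH].
Qed.

Lemma prefix_ones_mono k a b : prefix (nseq k true) (a ++ false :: b) ->
  prefix (nseq k true) (a ++ true :: b).
Proof.
elim: k a => [|k IH] a; first by move=> _; exact: prefix0s.
by case: a => [|x a] //= /andP[-> /IH ->].
Qed.

Lemma infix_ones_mono k a b : infix (nseq k.+1 true) (a ++ false :: b) ->
  infix (nseq k.+1 true) (a ++ true :: b).
Proof.
elim: a => [|x a IH] /=; first by move=> ->; rewrite orbT.
case/orP => [/andP[-> /prefix_ones_mono ->]|/IH ->] //; exact: orbT.
Qed.

(** Having no run means that none starts at the first letter and none lies in the tail. Both events
    are decreasing in U, so Harris' inequality gives one factor 1 - p^(k+1) per letter. *)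
Lemma prob_no_run_ge (p : R) k n : 0 <= p <= 1 ->
  (1 - p ^+ k.+1) ^+ n <= prob p n (predC (infix (nseq k.+1 true))).
Proof.
move=> p01; elim: n => [|n IH]; first by rewrite expr0 /prob.
pose F w : R := (~~ prefix (nseq k.+1 true) w)%:R.
pose G w : R := (~~ infix (nseq k.+1 true) (behead w))%:R.
have decF : decreasing_in_U F.
  move=> a b; rewrite ler_nat.
  have := @prefix_ones_mono k.+1 a b.
  by case: (prefix _ (_ ++ false :: _)) => [/(_ isT) ->|_] //; exact: leq_b1.
have decG : decreasing_in_U G.
  move=> [|x a] b; rewrite ler_nat //=.
  have := @infix_ones_mono k a b; rewrite /=.
  by case: (infix _ (_ ++ false :: _)) => [/(_ isT) ->|_] //; exact: leq_b1.
have := harris p01 n.+1 decF decG.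
have -> : expect p n.+1 (fun w => F w * G w) = prob p n.+1 (predC (infix (nseq k.+1 true))).
  by apply: eq_expect => -[|b w] //= _; rewrite -natrM mulnb -negb_or.
have -> : expect p n.+1 G = prob p n (predC (infix (nseq k.+1 true))).
  by rewrite /= -/(prob p n _); rewrite /prob /=; ring.
apply: le_trans; rewrite exprS.
have Fge : 1 - p ^+ k.+1 <= expect p n.+1 F.
  have := prob_prefix_ones n.+1 k.+1 p01.
  have := prob_predC p n.+1 (prefix (nseq k.+1 true)); rewrite /prob -/F => ->; lra.
case/andP: (p01) => p0 p1; have pk1 : p ^+ k.+1 <= 1 by rewrite exprn_ile1.
by apply: ler_pM => //; rewrite ?exprn_ge0 ?subr_ge0.
Qed.

Lemma prob_run_ge (p : R) k n : 0 <= p <= 1 ->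
  prob p n (infix (nseq k.+1 true)) <= prob p n (modw (run_sentence k)).
Proof. by move=> p01; apply: le_prob => // w _; apply: modw_run_sentence. Qed.

(** The factor 1 - p is the probability that the first letter is [false]; then no run wraps around
    and circular runs are factors of the rest. *)
Lemma prob_run_le (p : R) k n : 0 <= p <= 1 ->
  (1 - p) * prob p n (predC (infix (nseq k.+1 true))) <=
  1 - prob p n.+1 (modw (run_sentence k)).
Proof.
move=> p01; rewrite -prob_predC {2}/prob /=.
case/andP: (p01) => p0 p1.
have := prob_ge0 p01 n (fun w => ~~ modw (run_sentence k) (true :: w)).
have : prob p n (predC (infix (nseq k.+1 true))) <=
    prob p n (fun w => ~~ modw (run_sentence k) (false :: w)).
  by apply: le_prob => // w _; apply: contra; apply: modw_run_sentence_false.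
rewrite /prob /=; nra.
Qed.

Lemma runs_rare_cvg (p : nat -> R) k : (\forall n \near \oo, 0 <= p n <= 1) ->
  pr_models n (p n) (run_sentence k) @[n --> \oo] --> (0 : R) ->
  n%:R * p n ^+ k.+1 @[n --> \oo] --> (0 : R).
Proof.
move=> p01 P0.
(* With j disjoint blocks of length k + 1, (1 - P)(1 + j d) <= 1 and P < 1/2 give j d <= 2 P, while
   n <= 2 (k + 1) j; hence the constant 4 (k + 1). *)
have P4 : (4 * k.+1%:R) * pr_models n (p n) (run_sentence k) @[n --> \oo] --> (0 : R).
  by rewrite -(mulr0 (4 * k.+1%:R : R)); apply: cvgM => //; exact: cvg_cst.
apply: (squeeze_cvgr _ (cvg_cst _) P4); near=> n.
have pn : 0 <= p n <= 1 by near: n.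
have pk0 : 0 <= p n ^+ k.+1 by rewrite exprn_ge0 //; case/andP: pn.
rewrite mulr_ge0 //=.
have P_half : pr_models n (p n) (run_sentence k) < 2^-1.
  by near: n; apply: (cvgr_lt 0) => //; rewrite invr_gt0.
rewrite pr_models_prob in P_half *.
have := prob_run_ge k n pn; have := prob_predC (p n) n (infix (nseq k.+1 true)).
set g := prob _ _ (predC _); set f := prob _ _ (infix _) => gE fP.
pose j := (n %/ k.+1)%N.
have iE : infix (nseq k.+1 true) (nseq k.+1 true) by exact: infix_refl.
have E_catr := @infix_catr _ (nseq k.+1 true).
have E_catl u v := @infix_catl _ (nseq k.+1 true) v u.
have := prob_avoid_exp E_catr E_catl j pn pk0 (prob_ones pn iE).
have := prob_avoid_anti E_catr pn (leq_trunc_div n k.+1).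
rewrite -/j -/g; set g' := prob _ _ _ => gg' bound.
have j1 : (1 <= j)%N by rewrite /j divn_gt0 //; near: n; exact: nbhs_infty_ge.
have nj : n%:R <= k.+1%:R * (2 * j%:R) :> R.
  by rewrite -!natrM ler_nat; have := ltn_ceil n (isT : (0 < k.+1)%N); rewrite -/j; nia.
set d := p n ^+ k.+1 in pk0 bound *; set P := prob _ _ _ in P_half fP *.
have jd0 : 0 <= j%:R * d by rewrite mulr_ge0.
have jd : j%:R * d <= 2 * P by nra.
apply: (@le_trans _ _ (k.+1%:R * (2 * j%:R) * d)); first exact: ler_wpM2r.
rewrite (mulrC 4) -!mulrA ler_wpM2l //; lra.
Unshelve. all: by end_near.
Qed.

Lemma runs_common_cvg (p : nat -> R) k : (\forall n \near \oo, 0 <= p n <= 1) ->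
  pr_models n (p n) (run_sentence k) @[n --> \oo] --> (1 : R) ->
  n%:R * p n ^+ k.+1 @[n --> \oo] --> +oo.
Proof.
(* If n p^(k+1) < A at a large n, then runs are absent with probability at least c: the factor 1/2
   bounds 1 - p, and the exponential bounds (1 - x)^n with x = p^(k+1). *)
move=> p01 P1; rewrite cvgryPge => A; pose c : R := 2^-1 * (expR (2 * `|A|))^-1.
have c0 : 0 < c by rewrite mulr_gt0 // invr_gt0 // expR_gt0.
near=> n; rewrite leNgt; apply/negP => npA.
have pn : 0 <= p n <= 1 by near: n.
case/andP: (pn) => p0 p1.
have n0 : (0 < n)%N by near: n; exact: nbhs_infty_gt.
(* Together with n p^(k+1) < A, this forces p <= 1/2. *)
have nA : 2 ^+ k.+1 * `|A| <= n%:R.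
  by near: n; exact: nbhs_infty_ger.
have Pc : 1 - c < pr_models n (p n) (run_sentence k).
  by near: n; apply: (cvgr_gt 1) => //; rewrite ltrBlDr ltrDl.
have := prob_no_run_ge k n.-1 pn; have := prob_run_le k n.-1 pn.
rewrite prednK // -pr_models_prob.
set g := prob _ _ _; set x := p n ^+ k.+1 in npA * => gP xg.
have x0 : 0 <= x by rewrite exprn_ge0.
have nxA : n%:R * x <= `|A| by apply: le_trans (ltW npA) (ler_norm A).
have p_half : p n <= 2^-1.
  rewrite -(@ler_pXn2r _ k.+1) ?nnegrE ?invr_ge0 // -/x exprVn.
  have n0' : 0 < (n%:R : R) by rewrite ltr0n.
  rewrite -(ler_pM2l n0') ler_pdivlMr ?exprn_gt0 //.
  apply: le_trans nA; rewrite mulrC ler_wpM2l ?exprn_ge0 //.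
have x_half : x <= 2^-1.
  by apply: le_trans p_half; rewrite -[leRHS]expr1; apply: ler_wiXn2l.
have x1 : 0 <= 1 - x <= 1 by lra.
(* Indeed (1 - x)(1 + 2 x) = 1 + x (1 - 2 x), and x <= 1/2. *)
have e1 : 1 <= (1 - x) * expR (2 * x).
  have := expR_ge1Dx (2 * x); nra.
have e2 : 1 <= (1 - x) ^+ n * expR (2 * `|A|).
  apply: (@le_trans _ _ (((1 - x) * expR (2 * x)) ^+ n)).
    by rewrite exprn_ege1.
  rewrite exprMn; apply: ler_wpM2l; first by rewrite exprn_ge0 //; case/andP: x1.
  by rewrite -expRM_natl ler_expR; lra.
have e3 : (expR (2 * `|A|))^-1 <= (1 - x) ^+ n.
  by rewrite -[leLHS]mul1r ler_pdivrMr ?expR_gt0.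
have e4 : (1 - x) ^+ n <= (1 - x) ^+ n.-1.
  by case/andP: x1 => ? ?; apply: ler_wiXn2l => //; exact: leq_pred.
have : c <= (1 - p n) * g.
  apply: ler_pM; [by rewrite invr_ge0|by rewrite invr_ge0 expR_ge0|lra|].
  exact: le_trans e3 (le_trans e4 xg).
lra.
Unshelve. all: by end_near.
Qed.

Lemma zero_one_law_dichotomy (p : nat -> R) : (\forall n \near \oo, 0 <= p n <= 1) ->
  zero_one_law p -> forall k, (0 < k)%N ->
  n%:R * p n ^+ k @[n --> \oo] --> (0 : R) \/ n%:R * p n ^+ k @[n --> \oo] --> +oo.
Proof.
move=> p01 law [//|k] _; case: (law (run_sentence k)) => H; [left|right].
  exact: runs_rare_cvg.
exact: runs_common_cvg.
Qed.

End Runs.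

(** * Combining the regimes for p and 1 - p *)

Lemma zero_one_law_cases (R : realType) (p : nat -> R)
    (hp : forall n : nat, (0 < n)%N -> 0 <= p n <= 1) :
  ll_pow p 1 \/ (exists k : nat, (0 < k)%N /\
    pow_ll (k%:R^-1) p /\ ll_pow p (k.+1%:R^-1)) -> zero_one_law p.
Proof.
have p_ge0 : \forall n \near \oo, 0 <= p n by exists 1%N => // n /= /hp /andP[].
case=> [lp|[k [k0 [pk pk1]]]].
  apply: zero_one_empty => //; under eq_fun do rewrite -[X in _ * X]expr1.
  by apply/(ll_powP p_ge0) => //; rewrite invr1.
by apply: (zero_one_power hp k0); [apply/(pow_llP p_ge0)|apply/(ll_powP p_ge0)].
Qed.

Lemma dichotomy_cases (R : realType) (p : nat -> R) :
  (\forall n \near \oo, 0 <= p n) ->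
  (forall k, (0 < k)%N -> n%:R * p n ^+ k @[n --> \oo] --> (0 : R) \/
    n%:R * p n ^+ k @[n --> \oo] --> +oo) ->
  [\/ ll_pow p 1, (exists k : nat, (0 < k)%N /\
    pow_ll (k%:R^-1) p /\ ll_pow p (k.+1%:R^-1)) |
    forall eps : R, 0 < eps -> pow_ll eps p].
Proof.
move=> p_ge0 dich; pose small k := `[< n%:R * p n ^+ k.+1 @[n --> \oo] --> (0 : R) >].
have [ex_small|no_small] := pselect (exists k, small k); last first.
  apply: Or33; apply/(pow_ll_all p_ge0) => -[//|k] _.
  by case: (dich k.+1 isT) => // sk; case: no_small; exists k; apply/asboolP.
(* The least vanishing exponent fixes the regime: exponent 1 is the sparse case, and otherwise the
   previous exponent must diverge. *)
case: (ex_minnP ex_small) => -[|k] /asboolP sk min_k.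
  by apply: Or31; rewrite -invr1; apply/(ll_powP p_ge0 (k := 1)).
apply: Or32; exists k.+1; split=> //; split; last exact/(ll_powP p_ge0).
apply/(pow_llP p_ge0) => //; case: (dich k.+1 isT) => // sk'.
by have := min_k k; rewrite ltnn => /(_ (asboolT sk')).
Qed.

Theorem theorem1 (R : realType) (p : nat -> R)
    (hp : forall n : nat, (0 < n)%N -> 0 <= p n <= 1) :
  let q := fun n : nat => 1 - p n in
  let one_of_i_to_v :=
    ll_pow p 1
    \/ (exists k : nat, (0 < k)%N /\
          pow_ll (k%:R^-1) p /\ ll_pow p (k.+1%:R^-1))
    \/ (forall eps : R, 0 < eps -> pow_ll eps p /\ pow_ll eps q)
    \/ (exists k : nat, (0 < k)%N /\
          pow_ll (k%:R^-1) q /\ ll_pow q (k.+1%:R^-1))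
    \/ ll_pow q 1 in
  (one_of_i_to_v -> zero_one_law p) /\ (~ one_of_i_to_v -> ~ zero_one_law p).
Proof.
move=> q; have hq n : (0 < n)%N -> 0 <= q n <= 1 by move=> /hp; rewrite /q; lra.
have p_ge0 : \forall n \near \oo, 0 <= p n by exists 1%N => // n /= /hp /andP[].
have q_ge0 : \forall n \near \oo, 0 <= q n by exists 1%N => // n /= /hq /andP[].
have pE : p = fun n => 1 - q n by apply: funext => n; rewrite /q subKr.
split=> [|none law].
  case=> [h|[h|[h|h]]].
  - by apply: zero_one_law_cases => //; left.
  - by apply: zero_one_law_cases => //; right.
  - apply: zero_one_middle => //.
      by apply/(pow_ll_all p_ge0) => eps /h[].
    by apply/(pow_ll_all q_ge0) => eps /h[].
  - rewrite pE; apply: zero_one_law_swap; apply: zero_one_law_cases => //.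
    by case: h; [right|left].
have p01 : \forall n \near \oo, 0 <= p n <= 1 by exists 1%N => // n /= /hp.
have q01 : \forall n \near \oo, 0 <= q n <= 1 by exists 1%N => // n /= /hq.
have dich_p := zero_one_law_dichotomy p01 law.
have dich_q := zero_one_law_dichotomy q01 (zero_one_law_swap law).
(* If p falls in neither sparse regime, it dominates every negative power of n; the same trichotomy
   for q then yields (iii), (iv) or (v). *)
case: none; case: (dichotomy_cases p_ge0 dich_p) => hp'; [by left|by right; left|].
case: (dichotomy_cases q_ge0 dich_q) => hq'; [by do 4 right|by do 3 right; left|].
by do 2 right; left => eps e0; split; [apply: hp'|apply: hq'].
Qed.
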